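(* Let $\Omega=\{z\in\mathbb{C}^n \mid r(z)<0\}$ be a bounded domain with $C^{1,1}$-smooth boundary, where $r$ is a $C^{1,1}$ defining function with $dr\neq 0$ on $b\Omega$. Then there exists a constant $C>0$ such that \[ F^K_\Omega(z,X)\ge C\frac{|\langle\partial r(z),X\rangle|}{|r(z)|^{1/2}} \] for all $z\in\Omega$ and all $X\in\mathbb{C}^n$.
   Context: $\langle\partial r(z),X\rangle=\sum_{j=1}^n \frac{\partial r}{\partial z_j}(z)X_j$. For a domain $\Omega\subset\mathbb{C}^n$, $z\in\Omega$ and $X\in\mathbb{C}^n$, the Kobayashi(–Royden) metric is $F^K_\Omega(z,X)=\inf\{1/\lambda \mid \exists f\colon D\to\Omega \text{ holomorphic},\ f(0)=z,\ f'(0)=\lambda X,\ \lambda>0\}$, where $D$ is the unit disc in $\mathbb{C}$. *)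

(* Defs.v *)
From Stdlib Require Import Reals.
From Coquelicot Require Import Coquelicot.
From mathcomp Require Import ssreflect ssrfun ssrbool eqtype ssrnat fintype bigop.

Set Implicit Arguments.
Unset Strict Implicit.

Local Open Scope R_scope.

Definition Cn (n : nat) := 'I_n -> C.

Definition vsub {n} (z w : Cn n) : Cn n := fun k => Cminus (z k) (w k).

Definition cnorm {n} (z : Cn n) : R :=
  sqrt (\big[Rplus/0]_(j < n) (Cmod (z j) ^ 2)).

Definition ej {n} (j : 'I_n) : Cn n :=
  fun k => if k == j then RtoC 1 else RtoC 0.

Definition shift {n} (z : Cn n) (c : C) (j : 'I_n) : Cn n :=
  fun k => Cplus (z k) (Cmult c (ej j k)).

Definition cn_open_set {n} (A : Cn n -> Prop) : Prop :=
  forall z, A z -> exists d, 0 < d /\ forall w, cnorm (vsub w z) < d -> A w.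

Definition cn_closure {n} (A : Cn n -> Prop) (z : Cn n) : Prop :=
  forall d, 0 < d -> exists w, A w /\ cnorm (vsub w z) < d.

Definition cn_interior {n} (A : Cn n -> Prop) (z : Cn n) : Prop :=
  exists d, 0 < d /\ forall w, cnorm (vsub w z) < d -> A w.

Definition cn_bdry {n} (A : Cn n -> Prop) (z : Cn n) : Prop :=
  cn_closure A z /\ ~ cn_interior A z.

Definition cn_connected {n} (A : Cn n -> Prop) : Prop :=
  forall U V : Cn n -> Prop, cn_open_set U -> cn_open_set V ->
    (forall z, A z -> U z \/ V z) ->
    (forall z, A z -> U z -> V z -> False) ->
    (exists z, A z /\ U z) -> (exists z, A z /\ V z) -> False.

Definition cn_domain {n} (A : Cn n -> Prop) : Prop :=
  cn_open_set A /\ (exists z, A z) /\ cn_connected A.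

Definition cn_bounded {n} (A : Cn n -> Prop) : Prop :=
  exists M, forall z, A z -> cnorm z <= M.

Definition dx {n} (r : Cn n -> R) (z : Cn n) (j : 'I_n) : R :=
  Derive (fun t : R => r (shift z (RtoC t) j)) 0.
Definition dy {n} (r : Cn n -> R) (z : Cn n) (j : 'I_n) : R :=
  Derive (fun t : R => r (shift z (Cmult (RtoC t) Ci) j)) 0.

Definition dz {n} (r : Cn n -> R) (z : Cn n) (j : 'I_n) : C :=
  Cdiv (Cminus (RtoC (dx r z j)) (Cmult Ci (RtoC (dy r z j)))) (RtoC 2).

Definition dpair {n} (r : Cn n -> R) (z X : Cn n) : C :=
  \big[Cplus/RtoC 0]_(j < n) Cmult (dz r z j) (X j).

Definition C11_on {n} (U : Cn n -> Prop) (r : Cn n -> R) : Prop :=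
  (forall z, U z -> forall j,
      ex_derive (fun t : R => r (shift z (RtoC t) j)) 0 /\
      ex_derive (fun t : R => r (shift z (Cmult (RtoC t) Ci) j)) 0) /\
  (forall p, U p -> exists d L, 0 < d /\
      (forall w, cnorm (vsub w p) < d -> U w) /\
      forall z w j, cnorm (vsub z p) < d -> cnorm (vsub w p) < d ->
        Rabs (dx r z j - dx r w j) <= L * cnorm (vsub z w) /\
        Rabs (dy r z j - dy r w j) <= L * cnorm (vsub z w)).

Definition dr_nonzero {n} (r : Cn n -> R) (p : Cn n) : Prop :=
  exists j, dx r p j <> 0 \/ dy r p j <> 0.

Definition holo_disc_into {n} (Om : Cn n -> Prop) (f : C -> Cn n) : Prop :=
  forall w : C, Cmod w < 1 ->
    Om (f w) /\
    forall j, @ex_derive C_AbsRing C_NormedModule (fun u : C => f u j) w.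

(** Kobayashi(-Royden) metric, as an extended real (inf of empty set = +oo) *)
Definition kobayashi {n} (Om : Cn n -> Prop) (z X : Cn n) : Rbar :=
  Glb_Rbar (fun s : R => exists (f : C -> Cn n) (lam : R),
    0 < lam /\ s = / lam /\ holo_disc_into Om f /\
    (forall j, f (RtoC 0) j = z j) /\
    (forall j, @is_derive C_AbsRing C_NormedModule (fun u : C => f u j)
                 (RtoC 0) (Cmult (RtoC lam) (X j)))).

(* Main.v *)
(* Let f be a holomorphic disc in Omega with f(0) = z and f'(0) = lambda X.  Taylor's formula for r
   gives, for all w in Omega, Re <2 dr(z), w - z> <= |r(z)| + K |w - z|^2 with K uniform: near z
   because r(w) < 0, and far from z because Omega is bounded.  Since Omega is bounded, f moves
   points of the circle of radius rho by at most C rho, so the holomorphic function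
   g = <2 dr(z), f - z> has real part at most |r(z)| + K C^2 rho^2 there.  The Borel-Caratheodory
   inequality bounds rho |g'(0)| = 2 rho lambda |<dr(z), X>| by four times this, and
   rho ~ |r(z)|^(1/2) is the optimal choice.

   The complex analysis rests on Goursat's argument (repeated quadrisection of a rectangle), carried
   out in logarithmic polar coordinates, where it says that circle means are constant. *)
Require Import Defs.
From Stdlib Require Import Reals Lra Lia ClassicalEpsilon FunctionalExtensionality.
From Coquelicot Require Import Coquelicot.
From mathcomp Require Import ssreflect ssrfun ssrbool eqtype ssrnat seq fintype bigop.
Local Open Scope R_scope.

(** * Goursat's theorem for closed forms on rectangles *)

(** Every left endpoint is at most every right endpoint, so the supremum of the left endpoints lies
    in all the intervals. *)
Lemma nested_intervals (x w : nat -> R) :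
  (forall k, 0 <= w k) ->
  (forall k, x k <= x (S k)) ->
  (forall k, x (S k) + w (S k) <= x k + w k) ->
  exists l, forall k, x k <= l <= x k + w k.
Proof.
move=> w0 xup xdn.
have up : forall m k, x k <= x (m + k)%coq_nat.
  elim=> [|m IH] k /=; first lra.
  by have := IH k; have := xup (m + k)%coq_nat; lra.
have dn : forall m k, x (m + k)%coq_nat + w (m + k)%coq_nat <= x k + w k.
  elim=> [|m IH] k /=; first lra.
  by have := IH k; have := xdn (m + k)%coq_nat; lra.
have cross : forall k m, x m <= x k + w k.
  move=> k m; case: (Compare_dec.le_lt_dec k m) => km.
    have := dn (Nat.sub m k) k; have := w0 m.
    by have -> : (Nat.sub m k + k = m)%coq_nat by [lia]; lra.
  have := up (Nat.sub k m) m; have := w0 k.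
  by have -> : (Nat.sub k m + m = k)%coq_nat by [lia]; lra.
have [] := completeness (fun y => exists k, y = x k).
- by exists (x O + w O) => y [k ->]; apply: cross.
- by exists (x O), O.
move=> l [ub lub]; exists l => k; split.
  by apply: ub; exists k.
by apply: lub => y [m ->]; apply: cross.
Qed.

Lemma geometric_small (w d : R) : 0 <= w -> 0 < d ->
  exists N, forall k, (k >= N)%coq_nat -> w * (/ 2) ^ k < d.
Proof.
move=> w0 d0.
have h2 : Rabs (/ 2) < 1 by rewrite Rabs_pos_eq; lra.
have dw : 0 < d / (w + 1) by apply: Rdiv_lt_0_compat; lra.
have [N HN] := pow_lt_1_zero (/ 2) h2 _ dw.
exists N => k kN; have := HN k kN.
have p0 : 0 < (/ 2) ^ k by apply: pow_lt; lra.
rewrite Rabs_pos_eq; last lra.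
move=> H.
have : (w + 1) * (/ 2) ^ k < d.
  rewrite Rmult_comm; apply/Rlt_div_r => //; lra.
nra.
Qed.

(** An induction principle for rectangles: [T k x y] is about the rectangle with lower left corner
    [(x, y)] and sides [w / 2^k], [h / 2^k]. If [T] failed at level 0, some quarter would fail at
    each level; the failing rectangles shrink to a point, where the local hypothesis is
    contradicted. *)
Lemma quadrisection (a c w h : R) (T : nat -> R -> R -> Prop) :
  0 <= w -> 0 <= h ->
  (forall k x y,
     T (S k) x y -> T (S k) (x + w * (/ 2) ^ S k) y ->
     T (S k) x (y + h * (/ 2) ^ S k) ->
     T (S k) (x + w * (/ 2) ^ S k) (y + h * (/ 2) ^ S k) -> T k x y) ->
  (forall x y, a <= x <= a + w -> c <= y <= c + h ->
     exists d, 0 < d /\ forall k x' y', w * (/ 2) ^ k < d -> h * (/ 2) ^ k < d ->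
       x' <= x <= x' + w * (/ 2) ^ k -> y' <= y <= y' + h * (/ 2) ^ k ->
       T k x' y') ->
  T O a c.
Proof.
move=> w0 h0 split loc; apply: NNPP => nT.
have half k : (/ 2) ^ k = 2 * (/ 2) ^ S k by rewrite /=; field.
have pos k : 0 <= (/ 2) ^ k by apply: pow_le; lra.
(* Failure of [T] is a premise under the existential, so that choice yields a total map on corners;
   that the chosen sequence really fails at each level is proved afterwards. *)
have next : forall k (p : R * R), exists q : R * R, ~ T k p.1 p.2 ->
    ~ T (S k) q.1 q.2 /\
    (p.1 <= q.1 /\ q.1 + w * (/ 2) ^ S k <= p.1 + w * (/ 2) ^ k) /\
    (p.2 <= q.2 /\ q.2 + h * (/ 2) ^ S k <= p.2 + h * (/ 2) ^ k).
  move=> k [x y] /=.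
  have := half k; have := pos (S k).
  rewrite [(/ 2) ^ S k]/=; move: (/ 2 * (/ 2) ^ k) (split k x y) => e /=.
  move: (half k) => /= -> sp e0 Ee.
  case: (excluded_middle_informative (T (S k) x y)) => T1; last first.
    by exists (x, y) => /= _; split=> //; nra.
  case: (excluded_middle_informative (T (S k) (x + w * (/ 2 * (/ 2) ^ k)) y)) => T2; last first.
    by exists (x + w * (/ 2 * (/ 2) ^ k), y) => /= _; split=> //; nra.
  case: (excluded_middle_informative (T (S k) x (y + h * (/ 2 * (/ 2) ^ k)))) => T3; last first.
    by exists (x, y + h * (/ 2 * (/ 2) ^ k)) => /= _; split=> //; nra.
  exists (x + w * (/ 2 * (/ 2) ^ k), y + h * (/ 2 * (/ 2) ^ k)) => /= nTk; split; last nra.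
  by move=> T4; apply: nTk; apply: split.
pose nx k p := proj1_sig (constructive_indefinite_description _ (next k p)).
pose s := fix s k := match k with O => (a, c) | S k => nx k (s k) end.
have nxP k p := proj2_sig (constructive_indefinite_description _ (next k p)).
have sT : forall k, ~ T k (s k).1 (s k).2.
  by elim=> [|k IH] //=; apply: (proj1 (nxP k (s k) IH)).
have [x Hx] := nested_intervals (fun k => (s k).1) (fun k => w * (/ 2) ^ k)
  (fun k => Rmult_le_pos _ _ w0 (pos k))
  (fun k => proj1 (proj1 (proj2 (nxP k (s k) (sT k)))))
  (fun k => proj2 (proj1 (proj2 (nxP k (s k) (sT k))))).
have [y Hy] := nested_intervals (fun k => (s k).2) (fun k => h * (/ 2) ^ k)
  (fun k => Rmult_le_pos _ _ h0 (pos k))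
  (fun k => proj1 (proj2 (proj2 (nxP k (s k) (sT k)))))
  (fun k => proj2 (proj2 (proj2 (nxP k (s k) (sT k))))).
have [||d [d0 Hd]] := loc x y.
- by have /= := Hx O; lra.
- by have /= := Hy O; lra.
have [N1 HN1] := geometric_small w d w0 d0.
have [N2 HN2] := geometric_small h d h0 d0.
apply: (sT (N1 + N2)%coq_nat); apply: Hd => //.
- by apply: HN1; lia.
- by apply: HN2; lia.
Qed.

(** The counterclockwise integral of the form P dx + Q dy along the boundary of [a,b] x [c,d]. *)
Definition circulation (P Q : R -> R -> R) (a b c d : R) : R :=
  RInt (fun x => P x c) a b - RInt (fun x => P x d) a b
  + RInt (fun y => Q b y) c d - RInt (fun y => Q a y) c d.

Definition differentiable_at (P : R -> R -> R) (x y : R) : Prop :=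
  exists lx ly, differentiable_pt_lim P x y lx ly.

Lemma derivable_pt_lim_continuous (f : R -> R) (x l : R) :
  derivable_pt_lim f x l -> continuous f x.
Proof.
by move=> /is_derive_Reals fl; apply: (@ex_derive_continuous _ R_NormedModule); exists l.
Qed.

Lemma differentiable_ex_RInt_horizontal (P : R -> R -> R) (a b c : R) : a <= b ->
  (forall x, a <= x <= b -> differentiable_at P x c) ->
  ex_RInt (fun x => P x c) a b.
Proof.
move=> ab dP; apply: (@ex_RInt_continuous R_CompleteNormedModule) => x.
rewrite Rmin_left // Rmax_right // => /dP [lx [ly dx]].
apply: (derivable_pt_lim_continuous _ _ (lx * 1 + ly * 0)).
exact: (derivable_pt_lim_comp_2d P (fun x => x) (fun _ => c) _ _ _ _ _ dx
  (derivable_pt_lim_id _) (derivable_pt_lim_const _ _)).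
Qed.

Lemma differentiable_ex_RInt_vertical (P : R -> R -> R) (a c d : R) : c <= d ->
  (forall y, c <= y <= d -> differentiable_at P a y) ->
  ex_RInt (fun y => P a y) c d.
Proof.
move=> cd dP; apply: (@ex_RInt_continuous R_CompleteNormedModule) => y.
rewrite Rmin_left // Rmax_right // => /dP [lx [ly dx]].
apply: (derivable_pt_lim_continuous _ _ (lx * 0 + ly * 1)).
exact: (derivable_pt_lim_comp_2d P (fun _ => a) (fun y => y) _ _ _ _ _ dx
  (derivable_pt_lim_const _ _) (derivable_pt_lim_id _)).
Qed.

(** The common edge at [m] is traversed twice in opposite directions, and the horizontal edges add
    up by Chasles. *)
Lemma circulation_split_horizontal (P Q : R -> R -> R) (a m b c d : R) :
  a <= m -> m <= b -> c <= d ->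
  (forall x y, a <= x <= b -> c <= y <= d -> differentiable_at P x y) ->
  circulation P Q a b c d = circulation P Q a m c d + circulation P Q m b c d.
Proof.
move=> am mb cd dP; rewrite /circulation.
have E y : c <= y <= d ->
    RInt (fun x => P x y) a b = RInt (fun x => P x y) a m + RInt (fun x => P x y) m b.
  move=> ycd; rewrite -(RInt_Chasles (V := R_CompleteNormedModule) _ a m b) //.
  - by apply: differentiable_ex_RInt_horizontal => // x xam; apply: dP => //; lra.
  - by apply: differentiable_ex_RInt_horizontal => // x xam; apply: dP => //; lra.
by rewrite !E; lra.
Qed.

Lemma circulation_split_vertical (P Q : R -> R -> R) (a b c m d : R) :
  a <= b -> c <= m -> m <= d ->
  (forall x y, a <= x <= b -> c <= y <= d -> differentiable_at Q x y) ->
  circulation P Q a b c d = circulation P Q a b c m + circulation P Q a b m d.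
Proof.
move=> ab cm md dQ; rewrite /circulation.
have E x : a <= x <= b ->
    RInt (fun y => Q x y) c d = RInt (fun y => Q x y) c m + RInt (fun y => Q x y) m d.
  move=> ycd; rewrite -(RInt_Chasles (V := R_CompleteNormedModule) _ c m d) //.
  - by apply: differentiable_ex_RInt_vertical => // y yam; apply: dQ => //; lra.
  - by apply: differentiable_ex_RInt_vertical => // y yam; apply: dQ => //; lra.
by rewrite !E; lra.
Qed.

Lemma RInt_sub_const_bound (f g : R -> R) (a b m e : R) : a <= b ->
  ex_RInt f a b -> ex_RInt g a b ->
  (forall x, a <= x <= b -> Rabs (f x - g x - m) <= e) ->
  Rabs (RInt f a b - RInt g a b - m * (b - a)) <= (b - a) * e.
Proof.
move=> ab If Ig H.
have Ifg : ex_RInt (fun x => f x - g x) a b by apply: (ex_RInt_minus (V := R_NormedModule)).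
have -> : RInt f a b - RInt g a b - m * (b - a) = RInt (fun x => f x - g x - m) a b.
  rewrite (RInt_minus (V := R_CompleteNormedModule)) //; last exact: ex_RInt_const.
  rewrite (RInt_minus (V := R_CompleteNormedModule)) // RInt_const.
  rewrite /minus /plus /opp /scal /= /mult /=; ring.
apply: abs_RInt_le_const => //.
by apply: (ex_RInt_minus (V := R_NormedModule)) => //; apply: ex_RInt_const.
Qed.

(* Near a point where both forms are differentiable, the linear parts of [P] and [Q]
   contribute [(Q_x - P_y)] times the area, which vanishes for a closed form. *)
Lemma circulation_local (P Q : R -> R -> R) (x y px l qy e : R) : 0 < e ->
  differentiable_pt_lim P x y px l -> differentiable_pt_lim Q x y l qy ->
  exists r, 0 < r /\ forall a b c d, b - a < r -> d - c < r ->
    a <= x <= b -> c <= y <= d ->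
    (forall u v, a <= u <= b -> c <= v <= d -> differentiable_at P u v) ->
    (forall u v, a <= u <= b -> c <= v <= d -> differentiable_at Q u v) ->
    Rabs (circulation P Q a b c d) <= e * (2 * Rmax (b - a) (d - c) * (b - a + (d - c))).
Proof.
move=> e0 /(_ (mkposreal e e0)) [r1 H1] /(_ (mkposreal e e0)) [r2 H2].
exists (Rmin r1 r2); split; first by apply: Rmin_pos; [case: r1 {H1}|case: r2 {H2}].
move=> a b c d ba dc xab ycd dP dQ.
have rr1 := Rmin_l r1 r2; have rr2 := Rmin_r r1 r2.
set D := Rmax _ _.
have Dx u : a <= u <= b -> Rabs (u - x) <= b - a by move=> uab; apply: Rabs_le; lra.
have Dy u : c <= u <= d -> Rabs (u - y) <= d - c by move=> uab; apply: Rabs_le; lra.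
have DD u v : a <= u <= b -> c <= v <= d -> Rmax (Rabs (u - x)) (Rabs (v - y)) <= D.
  move=> uab vcd; apply: Rmax_lub.
    by apply: Rle_trans (Rmax_l _ _); apply: Dx.
  by apply: Rle_trans (Rmax_r _ _); apply: Dy.
have A1 u v : a <= u <= b -> c <= v <= d ->
    Rabs (P u v - P x y - (px * (u - x) + l * (v - y))) <= e * D.
  move=> uab vcd; apply: Rle_trans (H1 u v _ _) _.
  - by have := Dx u uab; lra.
  - by have := Dy v vcd; lra.
  - by rewrite /=; apply: Rmult_le_compat_l; [exact: Rlt_le e0|apply: DD].
have A2 u v : a <= u <= b -> c <= v <= d ->
    Rabs (Q u v - Q x y - (l * (u - x) + qy * (v - y))) <= e * D.
  move=> uab vcd; apply: Rle_trans (H2 u v _ _) _.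
  - by have := Dx u uab; lra.
  - by have := Dy v vcd; lra.
  - by rewrite /=; apply: Rmult_le_compat_l; [exact: Rlt_le e0|apply: DD].
(* The linear parts on opposite edges differ by constants: [l * (c - d)] here and [l * (b - a)] in
   [B2]. Multiplied by the edge lengths, they cancel. *)
have B1 : Rabs (RInt (fun u => P u c) a b - RInt (fun u => P u d) a b
            - (l * (c - d)) * (b - a)) <= (b - a) * (2 * (e * D)).
  apply: RInt_sub_const_bound; first lra.
  - by apply: differentiable_ex_RInt_horizontal => [|u uab]; [lra|apply: dP; lra].
  - by apply: differentiable_ex_RInt_horizontal => [|u uab]; [lra|apply: dP; lra].
  move=> u uab.
  have /Rabs_le_between ? := A1 u c uab ltac:(lra).
  have /Rabs_le_between ? := A1 u d uab ltac:(lra).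
  apply: Rabs_le; lra.
have B2 : Rabs (RInt (fun v => Q b v) c d - RInt (fun v => Q a v) c d
            - (l * (b - a)) * (d - c)) <= (d - c) * (2 * (e * D)).
  apply: RInt_sub_const_bound; first lra.
  - by apply: differentiable_ex_RInt_vertical => [|u uab]; [lra|apply: dQ; lra].
  - by apply: differentiable_ex_RInt_vertical => [|u uab]; [lra|apply: dQ; lra].
  move=> v vcd.
  have /Rabs_le_between ? := A2 b v ltac:(lra) vcd.
  have /Rabs_le_between ? := A2 a v ltac:(lra) vcd.
  apply: Rabs_le; lra.
move/Rabs_le_between: B1 => B1; move/Rabs_le_between: B2 => B2.
rewrite /circulation; apply: Rabs_le; lra.
Qed.

(** Goursat's argument: closedness means equal cross derivatives [l] at each point, with no
    continuity of the derivatives. A tolerance proportional to the area is additive under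
    quadrisection and is met by small rectangles. *)
Lemma circulation_closed_form (P Q : R -> R -> R) (a b c d : R) : a <= b -> c <= d ->
  (forall x y, a <= x <= b -> c <= y <= d -> exists px l qy,
     differentiable_pt_lim P x y px l /\ differentiable_pt_lim Q x y l qy) ->
  circulation P Q a b c d = 0.
Proof.
move=> ab cd dPQ.
have dP x y : a <= x <= b -> c <= y <= d -> differentiable_at P x y.
  by move=> xab ycd; have [px [l [qy [H _]]]] := dPQ x y xab ycd; exists px, l.
have dQ x y : a <= x <= b -> c <= y <= d -> differentiable_at Q x y.
  by move=> xab ycd; have [px [l [qy [_ H]]]] := dPQ x y xab ycd; exists l, qy.
set w := b - a; set h := d - c.
have pos k : 0 <= (/ 2) ^ k by apply: pow_le; lra.
have w0 : 0 <= w by rewrite /w; lra.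
have h0 : 0 <= h by rewrite /h; lra.
(* The geometric factor of [circulation_local] for the whole rectangle; at level [k] it shrinks by
   4^(-k). *)
set K := 2 * Rmax w h * (w + h).
have K0 : 0 <= K by have := Rmax_l w h; rewrite /K; nra.
apply: Rabs_eq_0; apply: Rle_antisym; last exact: Rabs_pos.
apply: le_epsilon => e e0; rewrite Rplus_0_l.
have eK : 0 < e / (K + 1) by apply: Rdiv_lt_0_compat; lra.
(* The premises confine the claim to subrectangles of the original. The tolerances of four quarters
   sum to that of the parent, and at level 0 the tolerance is below [e]; the [+ 1] covers
   [K = 0]. *)
pose T k x y := a <= x -> x + w * (/ 2) ^ k <= b -> c <= y -> y + h * (/ 2) ^ k <= d ->
  Rabs (circulation P Q x (x + w * (/ 2) ^ k) y (y + h * (/ 2) ^ k))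
    <= e / (K + 1) * (K * ((/ 2) ^ k * (/ 2) ^ k)).
have : T O a c.
  apply: (quadrisection a c w h) => //.
  - move=> k x y T1 T2 T3 T4 ax xb cy yd.
    have E2 : (/ 2) ^ k = 2 * (/ 2) ^ S k by rewrite /=; field.
    move: (pos (S k)) T1 T2 T3 T4 xb yd; rewrite /T E2.
    move: ((/ 2) ^ S k) => p p0 T1 T2 T3 T4 xb yd.
    have wp : 0 <= w * p by apply: Rmult_le_pos.
    have hp : 0 <= h * p by apply: Rmult_le_pos.
    have -> : x + w * (2 * p) = x + w * p + w * p by ring.
    have -> : y + h * (2 * p) = y + h * p + h * p by ring.
    rewrite (circulation_split_horizontal _ _ _ (x + w * p)); try lra; last first.
      by move=> u v ? ?; apply: dP; lra.
    have V x1 x2 : x <= x1 -> x1 <= x2 -> x2 <= x + w * p + w * p ->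
        circulation P Q x1 x2 y (y + h * p + h * p) =
        circulation P Q x1 x2 y (y + h * p) +
        circulation P Q x1 x2 (y + h * p) (y + h * p + h * p).
      move=> ? ? ?; apply: circulation_split_vertical; try lra.
      by move=> u v ? ?; apply: dQ; lra.
    rewrite !V; try lra.
    have /Rabs_le_between U1 := T1 ltac:(lra) ltac:(lra) ltac:(lra) ltac:(lra).
    have /Rabs_le_between U2 := T2 ltac:(lra) ltac:(lra) ltac:(lra) ltac:(lra).
    have /Rabs_le_between U3 := T3 ltac:(lra) ltac:(lra) ltac:(lra) ltac:(lra).
    have /Rabs_le_between U4 := T4 ltac:(lra) ltac:(lra) ltac:(lra) ltac:(lra).
    apply: Rabs_le; lra.
  - move=> x y xaw ych.
    have [||px [l [qy [Hp Hq]]]] := dPQ x y; [by rewrite /w in xaw; lra|by rewrite /h in ych; lra|].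
    have [r [r0 Hr]] := circulation_local P Q x y px l qy _ eK Hp Hq.
    exists r; split=> // k x' y' wr hr xx yy ax xb cy yd.
    apply: Rle_trans (Hr _ _ _ _ _ _ _ _ _ _) _; try lra.
    + by move=> u v ? ?; apply: dP; lra.
    + by move=> u v ? ?; apply: dQ; lra.
    have -> : x' + w * (/ 2) ^ k - x' = (/ 2) ^ k * w by ring.
    have -> : y' + h * (/ 2) ^ k - y' = (/ 2) ^ k * h by ring.
    rewrite (RmaxRmult _ _ _ (pos k)); apply: Rmult_le_compat_l; first lra.
    by apply: Req_le; rewrite /K; ring.
rewrite /T /= !Rmult_1_r.
have -> : a + w = b by rewrite /w; ring.
have -> : c + h = d by rewrite /h; ring.
move=> /(_ (Rle_refl _) (Rle_refl _) (Rle_refl _) (Rle_refl _)) H.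
apply: Rle_trans H _.
have -> : e / (K + 1) * K = e - e / (K + 1) by field; lra.
lra.
Qed.

(** * Holomorphic functions on the unit disc *)

(** Serves the polar components [exp s * cos t] and [exp s * sin t]. Multiplication deviates from
    its linear part exactly by the product of the two increments, which is of second order. *)
Lemma differentiable_pt_lim_mult_separate (f g : R -> R) (x y f' g' : R) :
  derivable_pt_lim f x f' -> derivable_pt_lim g y g' ->
  differentiable_pt_lim (fun u v => f u * g v) x y (f' * g y) (f x * g').
Proof.
move=> df dg.
have Dmult : differentiable_pt_lim Rmult (f x) (g y) (g y) (f x).
  move=> eps; exists eps => u v _ Hv.
  have -> : u * v - f x * g y - (g y * (u - f x) + f x * (v - g y)) =
            (u - f x) * (v - g y) by ring.
  rewrite Rabs_mult Rmult_comm.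
  apply: Rmult_le_compat; try exact: Rabs_pos; first exact: Rlt_le.
  exact: Rmax_l.
have Dsnd : differentiable_pt_lim (fun _ v => v) x y 0 1.
  move=> eps; exists eps => u v _ _.
  have -> : v - y - (0 * (u - x) + 1 * (v - y)) = 0 by ring.
  rewrite Rabs_R0; apply: Rmult_le_pos; first exact: Rlt_le (cond_pos eps).
  exact: Rle_trans (Rabs_pos _) (Rmax_l _ _).
have D1 := differentiable_pt_lim_proj1_0 f x y f' df.
have D2 := differentiable_pt_lim_comp _ (fun _ v => v) (fun _ v => v) x y _ _ _ _ _ _
  (differentiable_pt_lim_proj1_0 g y y g' dg) Dsnd Dsnd.
have := differentiable_pt_lim_comp Rmult (fun u _ => f u) (fun _ v => g v) x y
  _ _ _ _ _ _ Dmult D1 D2.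
have -> : g y * f' + f x * (g' * 0 + 0 * 0) = f' * g y by ring.
by have -> : g y * 0 + f x * (g' * 1 + 0 * 1) = f x * g' by ring.
Qed.

Definition C_is_derive (f : C -> C) (w l : C) : Prop :=
  @is_derive C_AbsRing C_NormedModule f w l.

Lemma C_is_deriveP (f : C -> C) (w l : C) :
  C_is_derive f w l <->
  forall e, 0 < e -> exists d, 0 < d /\ forall y, Cmod (y - w)%C < d ->
    Cmod (f y - f w - (y - w) * l)%C <= e * Cmod (y - w)%C.
Proof.
split=> [[_ H] e e0|H].
  have [d Hd] := H w (fun P HP => HP) (mkposreal e e0).
  by exists d; split; [exact: cond_pos|exact: Hd].
split; first exact: is_linear_scal_l.
move=> x Hx eps.
have {x Hx} -> : x = w by symmetry; apply: is_filter_lim_locally_unique.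
have [d [d0 Hd]] := H eps (cond_pos eps).
by exists (mkposreal d d0) => y; apply: Hd.
Qed.

Lemma Cmod_le_2Rmax (z : C) : Cmod z <= 2 * Rmax (Rabs (fst z)) (Rabs (snd z)).
Proof.
apply: Rle_trans (Cmod_2Rmax z) _; apply: Rmult_le_compat_r.
  exact: Rle_trans (Rabs_pos _) (Rmax_l _ _).
rewrite -{2}(sqrt_Rsqr 2); last lra.
by apply: sqrt_le_1_alt; rewrite /Rsqr; lra.
Qed.

Lemma Rabs_fst_le_Cmod (z : C) : Rabs (fst z) <= Cmod z.
Proof. exact: Rle_trans (Rmax_l _ _) (Rmax_Cmod z). Qed.

Lemma Rabs_snd_le_Cmod (z : C) : Rabs (snd z) <= Cmod z.
Proof. exact: Rle_trans (Rmax_r _ _) (Rmax_Cmod z). Qed.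

(** The Cauchy-Riemann equations: the gradients are the rows of the real matrix of multiplication by
    [l]. *)
Lemma C_is_derive_differentiable (f : C -> C) (x y : R) (l : C) :
  C_is_derive f (x, y) l ->
  differentiable_pt_lim (fun u v => fst (f (u, v))) x y (fst l) (- snd l) /\
  differentiable_pt_lim (fun u v => snd (f (u, v))) x y (snd l) (fst l).
Proof.
move=> /C_is_deriveP df.
have H (eps : posreal) : locally_2d (fun u v =>
    Cmod (f (u, v) - f (x, y) - ((u, v) - (x, y)) * l)%C
      <= eps * Rmax (Rabs (u - x)) (Rabs (v - y))) x y.
  have e0 := cond_pos eps.
  have [|d [d0 Hd]] := df (eps / 2); first lra.
  have d2 : 0 < d / 2 by lra.
  exists (mkposreal _ d2) => u v ux vy.
  have M := Cmod_le_2Rmax ((u, v) - (x, y))%C.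
  apply: Rle_trans (Hd (u, v) _) _.
    apply: Rle_lt_trans M _ => /=.
    have := Rmax_lub_lt _ _ _ ux vy.
    by rewrite /= /Rminus; lra.
  rewrite /= in M.
  by rewrite /Rminus; nra.
split=> eps; have [d Hd] := H eps; exists d => u v ux vy; apply: Rle_trans (Hd u v ux vy).
- apply: Rle_trans (Rabs_fst_le_Cmod _); apply: Req_le; congr Rabs.
  by rewrite /=; ring.
- apply: Rle_trans (Rabs_snd_le_Cmod _); apply: Req_le; congr Rabs.
  by rewrite /=; ring.
Qed.

(** The map exp(s + i t): the circle of radius e^s becomes a vertical segment of length 2 pi. *)
Definition polar (s t : R) : C := (exp s * cos t, exp s * sin t).

Lemma Cmod_polar (s t : R) : Cmod (polar s t) = exp s.
Proof.
rewrite /Cmod /=.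
have -> : exp s * cos t * (exp s * cos t * 1) + exp s * sin t * (exp s * sin t * 1)
   = exp s * exp s * (Rsqr (sin t) + Rsqr (cos t)) by rewrite /Rsqr; ring.
rewrite sin2_cos2 Rmult_1_r; apply: sqrt_square; exact: Rlt_le (exp_pos s).
Qed.

(** The form Im f ds + Re f dt is the imaginary part of f d(s + i t), and f composed with exp is
    holomorphic in s + i t; the shared [l] is a Cauchy-Riemann equation. *)
Lemma C_is_derive_polar (f : C -> C) (s t : R) : (exists l, C_is_derive f (polar s t) l) ->
  exists px l qy,
    differentiable_pt_lim (fun s t => snd (f (polar s t))) s t px l /\
    differentiable_pt_lim (fun s t => fst (f (polar s t))) s t l qy.
Proof.
move=> [l /C_is_derive_differentiable [Hf Hs]].
have Dc := differentiable_pt_lim_mult_separate exp cos s t _ _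
  (derivable_pt_lim_exp s) (derivable_pt_lim_cos t).
have Ds := differentiable_pt_lim_mult_separate exp sin s t _ _
  (derivable_pt_lim_exp s) (derivable_pt_lim_sin t).
have Ps := differentiable_pt_lim_comp _ _ _ _ _ _ _ _ _ _ _ Hs Dc Ds.
have Qs := differentiable_pt_lim_comp _ _ _ _ _ _ _ _ _ _ _ Hf Dc Ds.
do 3 eexists; split; first exact: Ps.
have -> : snd l * (exp s * - sin t) + fst l * (exp s * cos t) =
  fst l * (exp s * cos t) + - snd l * (exp s * sin t) by ring.
exact: Qs.
Qed.

(* The form Im (G dz / z) is closed off the origin; the circulation around the rectangle
   with logarithmic polar coordinates is the difference of two circle means of [Re G]. *)
Lemma circle_mean_constant (G : C -> C) (s1 s2 : R) : s1 <= s2 ->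
  (forall w, w <> RtoC 0 -> Cmod w <= exp s2 -> exists l, C_is_derive G w l) ->
  RInt (fun t => fst (G (polar s1 t))) 0 (2 * PI) =
  RInt (fun t => fst (G (polar s2 t))) 0 (2 * PI) /\
  forall s, s1 <= s <= s2 -> ex_RInt (fun t => fst (G (polar s t))) 0 (2 * PI).
Proof.
move=> s12 dG.
have pi0 := PI_RGT_0.
have dP s t : s1 <= s <= s2 -> exists px l qy,
    differentiable_pt_lim (fun s t => snd (G (polar s t))) s t px l /\
    differentiable_pt_lim (fun s t => fst (G (polar s t))) s t l qy.
  move=> ss; apply: C_is_derive_polar; apply: dG.
    by move=> E; have := exp_pos s; rewrite -(Cmod_polar s t) E Cmod_0; lra.
  by rewrite Cmod_polar; case: (proj2 ss) => [/exp_increasing|->]; lra.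
split; last first.
  move=> s ss; apply: (differentiable_ex_RInt_vertical (fun s t => fst (G (polar s t)))); first lra.
  by move=> y _; have [px [l [qy [_ H]]]] := dP s y ss; exists l, qy.
have := circulation_closed_form (fun s t => snd (G (polar s t)))
  (fun s t => fst (G (polar s t))) s1 s2 0 (2 * PI) s12 ltac:(lra)
  (fun s t ss _ => dP s t ss).
rewrite /circulation.
(* The sides t = 0 and t = 2 pi cancel by periodicity, which leaves the two circle integrals. *)
have -> : RInt (fun x => snd (G (polar x (2 * PI)))) s1 s2 =
          RInt (fun x => snd (G (polar x 0))) s1 s2.
  by apply: RInt_ext => x _; rewrite /polar cos_2PI sin_2PI cos_0 sin_0.
lra.
Qed.

(** The mean over the circle of radius [rho] equals the mean over a tiny circle, which is close to
    the value at the centre by continuity. At the origin only continuity is asked, so that the lemma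
    applies to quotients by [w] extended by their limit. *)
Lemma Re_center_le_circle (G : C -> C) (rho A : R) : 0 < rho ->
  (forall w, w <> RtoC 0 -> Cmod w <= rho -> exists l, C_is_derive G w l) ->
  (forall e, 0 < e -> exists d, 0 < d /\
     forall w, Cmod w < d -> Cmod (G w - G (RtoC 0))%C <= e) ->
  (forall w, Cmod w = rho -> fst (G w) <= A) ->
  fst (G (RtoC 0)) <= A.
Proof.
move=> r0 dG cG GA; apply: le_epsilon => e e0.
have pi0 := PI_RGT_0.
have [d [d0 Hd]] := cG e e0.
set d' := Rmin rho (d / 2).
have d'0 : 0 < d' by apply: Rmin_pos; lra.
have d'r : d' <= rho by apply: Rmin_l.
have d'd : d' <= d / 2 by apply: Rmin_r.
have l12 : ln d' <= ln rho by apply: ln_le.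
have E2 : exp (ln rho) = rho by apply: exp_ln.
have [|E I] := circle_mean_constant G _ _ l12; first by rewrite E2.
have U2 : RInt (fun t => fst (G (polar (ln rho) t))) 0 (2 * PI) <= RInt (fun _ => A) 0 (2 * PI).
  apply: RInt_le; first lra; first by apply: I; lra.
    exact: ex_RInt_const.
  by move=> t _; apply: GA; rewrite Cmod_polar.
have U1 : RInt (fun _ => fst (G (RtoC 0)) - e) 0 (2 * PI) <=
          RInt (fun t => fst (G (polar (ln d') t))) 0 (2 * PI).
  apply: RInt_le; first lra; first exact: ex_RInt_const.
    by apply: I; lra.
  move=> t _; have := Hd (polar (ln d') t).
  rewrite Cmod_polar exp_ln // => /(_ ltac:(lra)).
  move=> H; have := Rle_trans _ _ _ (Rabs_fst_le_Cmod _) H.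
  by move=> /Rabs_le_between /=; lra.
move: U1 U2; rewrite E !RInt_const /scal /= /mult /=.
nra.
Qed.

(* [C_NormedModule] and [AbsRing_NormedModule C_AbsRing] carry the same norm on [C] but are
   not convertible; the product and chain rules are available for the latter. *)
Lemma C_is_derive_AbsRing (f : C -> C) (w l : C) :
  C_is_derive f w l <->
  @is_derive C_AbsRing (AbsRing_NormedModule C_AbsRing) f w l.
Proof.
by split=> -[_ H]; (split; first exact: is_linear_scal_l); exact: H.
Qed.

Lemma C_is_derive_mult (f g : C -> C) (w l m : C) :
  C_is_derive f w l -> C_is_derive g w m ->
  C_is_derive (fun u => f u * g u)%C w (l * g w + f w * m)%C.
Proof.
move=> /C_is_derive_AbsRing df /C_is_derive_AbsRing dg; apply/C_is_derive_AbsRing.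
exact: (is_derive_mult (K := C_AbsRing) f g w l m df dg Cmult_comm).
Qed.

Lemma C_is_derive_plus (f g : C -> C) (w l m : C) :
  C_is_derive f w l -> C_is_derive g w m ->
  C_is_derive (fun u => f u + g u)%C w (l + m)%C.
Proof. exact: is_derive_plus. Qed.

Lemma C_is_derive_const (a w : C) : C_is_derive (fun _ => a) w (RtoC 0).
Proof. exact: is_derive_const. Qed.

Lemma C_is_derive_id (w : C) : C_is_derive (fun u => u) w (RtoC 1).
Proof. by apply/C_is_derive_AbsRing; apply: is_derive_id. Qed.

Lemma C_is_derive_comp_affine (f : C -> C) (z c w l : C) :
  C_is_derive f (z + c * w)%C l -> C_is_derive (fun u => f (z + c * u))%C w (c * l)%C.
Proof.
move=> df.
have dg : C_is_derive (fun u => z + c * u)%C w c.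
  have := C_is_derive_plus _ _ w _ _ (C_is_derive_const z w)
    (C_is_derive_mult _ _ w _ _ (C_is_derive_const c w) (C_is_derive_id w)).
  by have -> : (RtoC 0 + (RtoC 0 * w + c * RtoC 1))%C = c by ring.
exact: (is_derive_comp f _ w l c df (proj1 (C_is_derive_AbsRing _ _ _) dg)).
Qed.

Lemma C_is_derive_ext_loc (f g : C -> C) (w l : C) (d : R) : 0 < d ->
  (forall y, Cmod (y - w)%C < d -> f y = g y) ->
  C_is_derive f w l -> C_is_derive g w l.
Proof.
move=> d0 fg /C_is_deriveP df; apply/C_is_deriveP => e e0.
have [d' [d'0 Hd']] := df e e0.
exists (Rmin d d'); split; first exact: Rmin_pos.
move=> y yd; rewrite -!fg.
- by apply: Hd'; apply: Rlt_le_trans yd (Rmin_r _ _).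
- have -> : (w - w)%C = RtoC 0 by ring.
  by rewrite Cmod_0.
- exact: Rlt_le_trans yd (Rmin_l _ _).
Qed.

Lemma Cmod_reverse_triangle (z w : C) : Cmod z <= Cmod w + Cmod (w - z)%C.
Proof.
have {1}-> : z = (w + - (w - z))%C by ring.
by apply: Rle_trans (Cmod_triangle _ _) _; rewrite Cmod_opp; lra.
Qed.

Lemma C_is_derive_inv (w : C) : w <> RtoC 0 ->
  C_is_derive (fun u => / u)%C w (- / (w * w))%C.
Proof.
move=> w0; apply/C_is_deriveP => e e0.
have m0 : 0 < Cmod w by apply/Cmod_gt_0.
have m3 : 0 < Cmod w * Cmod w * Cmod w by repeat apply: Rmult_lt_0_compat.
(* The remainder is (y - w)^2 / (y w^2). The first radius keeps |y| above |w|/2; the second then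
   makes |y - w| / (|y| |w|^2) at most [e]. *)
exists (Rmin (Cmod w / 2) (e * (Cmod w * Cmod w * Cmod w) / 2)); split.
  apply: Rmin_pos; first lra.
  have := Rmult_lt_0_compat _ _ e0 m3; lra.
move=> y yd.
have y1 : Cmod (y - w)%C < Cmod w / 2 by apply: Rlt_le_trans yd (Rmin_l _ _).
have y2 : Cmod (y - w)%C < e * (Cmod w * Cmod w * Cmod w) / 2
  by apply: Rlt_le_trans yd (Rmin_r _ _).
have yw : Cmod w / 2 < Cmod y by have := Cmod_reverse_triangle w y; lra.
have y0 : y <> RtoC 0 by apply/Cmod_gt_0; lra.
have -> : (/ y - / w - (y - w) * - / (w * w))%C = ((y - w) * ((y - w) / (y * (w * w))))%C
  by field.
have ww0 : (y * (w * w))%C <> RtoC 0 by do 2 ?apply: Cmult_neq_0.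
rewrite Cmod_mult Cmod_div // !Cmod_mult Rmult_comm.
apply: Rmult_le_compat_r; first exact: Cmod_ge_0.
have m2 : 0 < Cmod w * Cmod w by apply: Rmult_lt_0_compat.
have p0 : 0 < Cmod y * (Cmod w * Cmod w) by apply: Rmult_lt_0_compat; lra.
apply/Rle_div_l => //; apply: Rlt_le; apply: Rlt_le_trans y2 _.
have : Cmod w / 2 * (Cmod w * Cmod w) <= Cmod y * (Cmod w * Cmod w).
  by apply: Rmult_le_compat_r; lra.
move=> /(Rmult_le_compat_l e _ _ (Rlt_le _ _ e0)); lra.
Qed.

Definition C_holomorphic_on_disc (f : C -> C) : Prop :=
  forall w, Cmod w < 1 -> exists l, C_is_derive f w l.

(** As in the Schwarz lemma, h(w)/w extends continuously to the origin by h'(0) = m, and the mean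
    value inequality applies to the extension. *)
Lemma Re_derive_center_le (h : C -> C) (m : C) (rho A : R) : 0 < rho < 1 ->
  C_holomorphic_on_disc h -> h (RtoC 0) = RtoC 0 -> C_is_derive h (RtoC 0) m ->
  (forall w, Cmod w = rho -> fst (h w / w)%C <= A) -> fst m <= A.
Proof.
move=> r01 dh h0 dm hA.
pose G w := if excluded_middle_informative (w = RtoC 0) then m else (h w * / w)%C.
have G0 : G (RtoC 0) = m by rewrite /G; case: excluded_middle_informative.
have Gn w : w <> RtoC 0 -> G w = (h w * / w)%C.
  by rewrite /G; case: excluded_middle_informative.
rewrite -G0; apply: (Re_center_le_circle G rho A); first lra.
- move=> w w0 wr; have [|l dl] := dh w; first lra.
  have := C_is_derive_mult _ _ w _ _ dl (C_is_derive_inv w w0).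
  set l' := (_ + _)%C => dl'; exists l'.
  (* The disc of radius [Cmod w] around [w] omits the origin, so [G] is the quotient there. *)
  apply: C_is_derive_ext_loc dl'; first by apply/Cmod_gt_0; exact: w0.
  move=> y yw; rewrite Gn // => y0; move: yw; rewrite y0.
  have -> : (RtoC 0 - w)%C = (- w)%C by ring.
  by rewrite Cmod_opp; lra.
- move=> e e0; have [d [d0 Hd]] := proj1 (C_is_deriveP _ _ _) dm e e0.
  exists d; split=> // w wd; rewrite G0.
  case: (excluded_middle_informative (w = RtoC 0)) => w0.
    rewrite w0 G0; have -> : (m - m)%C = RtoC 0 by ring.
    by rewrite Cmod_0; lra.
  rewrite Gn //; have m0 : 0 < Cmod w by apply/Cmod_gt_0.
  have := Hd w; rewrite h0.
  have -> : (w - RtoC 0)%C = w by ring.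
  move=> /(_ wd).
  have -> : (h w - RtoC 0 - w * m)%C = (w * (h w * / w - m))%C by field.
  by rewrite Cmod_mult Rmult_comm => /(Rmult_le_reg_r _ _ _ m0).
- move=> w wr; rewrite Gn; first exact: hA.
  by apply/Cmod_gt_0; lra.
Qed.

(* With [a * b = |b|] and [|a| = 1], the factor [h w = conj a * w^2 / rho + 2 w + rho a]
   satisfies [0 <= h w / w <= 4] on the circle of radius [rho], while the derivative of
   [h * g] at the origin is [rho * |b|]. *)
Lemma borel_caratheodory_derive (g : C -> C) (b : C) (rho A : R) : 0 < rho < 1 -> 0 <= A ->
  C_holomorphic_on_disc g -> g (RtoC 0) = RtoC 0 -> C_is_derive g (RtoC 0) b ->
  (forall w, Cmod w = rho -> fst (g w) <= A) -> rho * Cmod b <= 4 * A.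
Proof.
move=> r01 A0 dg g0 db gA.
(* [a] is conj b / |b|, or 1 when [b] vanishes. *)
have [a [a1 ab]] : exists a, Cmod a = 1 /\ (a * b)%C = RtoC (Cmod b).
  case: (excluded_middle_informative (b = RtoC 0)) => b0.
    by exists (RtoC 1); rewrite b0 Cmod_1 Cmod_0; split=> //; ring.
  have m0 : Cmod b <> 0 by have : 0 < Cmod b by [apply/Cmod_gt_0]; lra.
  have cm0 : RtoC (Cmod b) <> RtoC 0 by move=> /RtoC_inj.
  exists (Cconj b / RtoC (Cmod b))%C; split.
    rewrite Cmod_div // Cmod_conj Cmod_R Rabs_pos_eq; first by field.
    exact: Cmod_ge_0.
  have := Cmod2_conj b; rewrite /= Rmult_1_r RtoC_mult => E.
  have -> : (Cconj b / RtoC (Cmod b) * b)%C = (b * Cconj b / RtoC (Cmod b))%C by field.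
  by rewrite -E; field.
have rC : RtoC rho <> RtoC 0 by move=> /RtoC_inj; lra.
pose h w := (Cconj a / RtoC rho * (w * w) + (RtoC 2 * w + RtoC rho * a))%C.
have dh w : C_is_derive h w (Cconj a / RtoC rho * (w + w) + RtoC 2)%C.
  have dw := C_is_derive_id w.
  have := C_is_derive_plus _ _ w _ _
    (C_is_derive_mult _ _ w _ _ (C_is_derive_const (Cconj a / RtoC rho)%C w)
      (C_is_derive_mult _ _ w _ _ dw dw))
    (C_is_derive_plus _ _ w _ _ (C_is_derive_mult _ _ w _ _ (C_is_derive_const (RtoC 2) w) dw)
      (C_is_derive_const (RtoC rho * a)%C w)).
  rewrite -/h; congr C_is_derive; ring.
have -> : rho * Cmod b = fst (RtoC (rho * Cmod b)) by [].
apply: (Re_derive_center_le (fun w => h w * g w)%C _ rho) => //.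
- move=> w /dg [l dl]; eexists; apply: C_is_derive_mult (dh w) dl.
- by rewrite g0; ring.
- have := C_is_derive_mult _ _ _ _ _ (dh (RtoC 0)) db.
  congr C_is_derive; rewrite g0 /h RtoC_mult -ab; ring.
- move=> w wr.
  have w0 : w <> RtoC 0 by apply/Cmod_gt_0; lra.
  (* On the circle [rho] equals w conj(w) / rho, so the outer two terms of [h w] combine to 2
     Re(conj(a) w) / rho times [w]. *)
  have hw : h w = (RtoC (2 + 2 * fst (Cconj a * w)%C / rho) * w)%C.
    have E1 : (Cconj a * w + a * Cconj w)%C = RtoC (2 * fst (Cconj a * w)%C).
      by apply: injective_projections; rewrite /=; ring.
    have E2 : (w * Cconj w)%C = (RtoC rho * RtoC rho)%C.
      by rewrite -Cmod2_conj wr -RtoC_mult; congr RtoC; ring.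
    have r0 : rho <> 0 by lra.
    rewrite RtoC_plus (RtoC_div _ _ r0) -E1.
    have -> : ((RtoC 2 + (Cconj a * w + a * Cconj w) / RtoC rho) * w)%C =
      (RtoC 2 * w + Cconj a / RtoC rho * (w * w) + a * (w * Cconj w) / RtoC rho)%C by field.
    by rewrite E2 /h; field.
  rewrite hw; set k := 2 + _.
  have -> : (RtoC k * w * g w / w)%C = (RtoC k * g w)%C by field.
  have -> : fst (RtoC k * g w)%C = k * fst (g w) by rewrite /=; ring.
  have : Rabs (fst (Cconj a * w)%C) <= rho.
    by apply: Rle_trans (Rabs_fst_le_Cmod _) _; rewrite Cmod_mult Cmod_conj a1 wr; lra.
  move=> /Rabs_le_between; move Ef: (fst _) => q q1.
  (* Since [k >= 0], the bound Re g <= A survives multiplication by [k]; then [k <= 4] and [A >= 0]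
     give 4 A. *)
  have k4 : 0 <= k <= 4.
    have : -1 <= q / rho <= 1 by split; [apply/Rle_div_r|apply/Rle_div_l]; lra.
    by rewrite /k Ef /Rdiv; lra.
  have := gA w wr; nra.
Qed.

(** The disc of radius 1/2 around [z] lies in the unit disc. Rescaled to it, f - f(z) has modulus at
    most 2 M, and the previous inequality at radius 1/2 reads |l|/4 <= 8 M. *)
Lemma C_derive_bound (f : C -> C) (M : R) (z l : C) :
  C_holomorphic_on_disc f -> (forall w, Cmod w < 1 -> Cmod (f w) <= M) ->
  Cmod z < / 2 -> C_is_derive f z l -> Cmod l <= 32 * M.
Proof.
move=> df fM z2 dl.
pose g w := (f (z + RtoC (/ 2) * w) + - f z)%C.
have h2 : Cmod (RtoC (/ 2)) = / 2 by rewrite Cmod_R Rabs_pos_eq; lra.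
have zw w : Cmod w < 1 -> Cmod (z + RtoC (/ 2) * w)%C < 1.
  by move=> w1; apply: Rle_lt_trans (Cmod_triangle _ _) _; rewrite Cmod_mult h2; lra.
have M0 : 0 <= M by apply: Rle_trans (Cmod_ge_0 _) (fM z _); lra.
have dg w m : C_is_derive f (z + RtoC (/ 2) * w)%C m -> C_is_derive g w (RtoC (/ 2) * m)%C.
  move=> /C_is_derive_comp_affine dm.
  have := C_is_derive_plus _ _ w _ _ dm (C_is_derive_const (- f z)%C w).
  congr C_is_derive; ring.
have z0 : (z + RtoC (/ 2) * RtoC 0)%C = z by ring.
have := borel_caratheodory_derive g (RtoC (/ 2) * l)%C (/ 2) (2 * M) ltac:(lra) ltac:(lra).
rewrite Cmod_mult h2.
suff H : / 2 * (/ 2 * Cmod l) <= 4 * (2 * M) -> Cmod l <= 32 * M.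
  move=> HB; apply: H; apply: HB.
  - by move=> w /zw /df [m /dg dm]; exists (RtoC (/ 2) * m)%C.
  - by rewrite /g z0; ring.
  - by apply: dg; rewrite z0.
  - move=> w wr; apply: Rle_trans (Rle_abs _) _; apply: Rle_trans (Rabs_fst_le_Cmod _) _.
    apply: Rle_trans (Cmod_triangle _ _) _; rewrite Cmod_opp.
    have := fM z ltac:(lra); have := fM _ (zw w ltac:(lra)); lra.
lra.
Qed.

(** The mean value theorem on the segment from 0 to [z], used for the real and imaginary parts
    separately; recombining them doubles the constant 32. *)
Lemma C_growth_bound (f : C -> C) (M : R) (z : C) :
  C_holomorphic_on_disc f -> (forall w, Cmod w < 1 -> Cmod (f w) <= M) ->
  Cmod z < / 2 -> Cmod (f z - f (RtoC 0))%C <= 64 * M * Cmod z.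
Proof.
move=> df fM z2.
have tz t : 0 <= t <= 1 -> Cmod (t * fst z, t * snd z) < / 2.
  move=> t01; have -> : (t * fst z, t * snd z) = (RtoC t * z)%C.
    by apply: injective_projections; rewrite /=; ring.
  by rewrite Cmod_mult Cmod_R Rabs_pos_eq; have := Cmod_ge_0 z; nra.
(* Both [p] and [dp] will be [fst], then both [snd]: [p] acts on values of [f], [dp] on its complex
   derivative. *)
have component (p : C -> R) (dp : C -> R) :
    (forall c, Rabs (dp c) <= Cmod c) ->
    (forall t l, C_is_derive f (t * fst z, t * snd z) l ->
       derivable_pt_lim (fun t => p (f (t * fst z, t * snd z))) t (dp (l * z)%C)) ->
    Rabs (p (f z) - p (f (RtoC 0))) <= 32 * M * Cmod z.
  move=> dpb Hd.
  (* The default value 0 outside [0,1] makes the derivative a total function, as the mean value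
     theorem expects. *)
  have H t : exists m, 0 <= t <= 1 ->
      derivable_pt_lim (fun t => p (f (t * fst z, t * snd z))) t m /\
      Rabs m <= 32 * M * Cmod z.
    case: (excluded_middle_informative (0 <= t <= 1)) => t01; last by exists 0.
    have [|l dl] := df (t * fst z, t * snd z); first by have := tz t t01; lra.
    exists (dp (l * z)%C) => _; split; first exact: Hd.
    apply: Rle_trans (dpb _) _; rewrite Cmod_mult; apply: Rmult_le_compat_r.
      exact: Cmod_ge_0.
    by apply: (C_derive_bound f M (t * fst z, t * snd z)) => //; apply: tz.
  pose m t := proj1_sig (constructive_indefinite_description _ (H t)).
  have mP t := proj2_sig (constructive_indefinite_description _ (H t)).
  have [||c [c01 E]] := MVT_gen (fun t => p (f (t * fst z, t * snd z))) 0 1 m.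
  - rewrite Rmin_left ?Rmax_right; try lra.
    by move=> t t01; apply/is_derive_Reals; apply: (proj1 (mP t _)); lra.
  - rewrite Rmin_left ?Rmax_right; try lra.
    move=> t t01; apply: derivable_continuous_pt; exists (m t).
    exact: (proj1 (mP t t01)).
  rewrite Rmin_left ?Rmax_right in c01; try lra.
  move: E; rewrite !Rmult_1_l !Rmult_0_l -surjective_pairing => ->.
  have := proj2 (mP c c01); rewrite -/(m c).
  by have -> : m c * (1 - 0) = m c by ring.
have D1 t : derivable_pt_lim (fun t => t * fst z) t (fst z).
  by apply/is_derive_Reals; auto_derive => //; ring.
have D2 t : derivable_pt_lim (fun t => t * snd z) t (snd z).
  by apply/is_derive_Reals; auto_derive => //; ring.
have F1 := component fst fst Rabs_fst_le_Cmod.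
have F2 := component snd snd Rabs_snd_le_Cmod.
apply: Rle_trans (Cmod_le_2Rmax _) _.
have -> : 64 * M * Cmod z = 2 * (32 * M * Cmod z) by ring.
apply: Rmult_le_compat_l; first lra.
apply: Rmax_lub => /=.
- apply: F1 => t l /C_is_derive_differentiable [H _].
  have := derivable_pt_lim_comp_2d _ _ _ t _ _ _ _ H (D1 t) (D2 t).
  congr derivable_pt_lim; rewrite /=; ring.
- apply: F2 => t l /C_is_derive_differentiable [_ H].
  have := derivable_pt_lim_comp_2d _ _ _ t _ _ _ _ H (D1 t) (D2 t).
  congr derivable_pt_lim; rewrite /=; ring.
Qed.

(** * Norms, compactness and Taylor estimates in complex space *)

Lemma big_Rplus_le (I : Type) (s : seq I) (F G : I -> R) :
  (forall j, F j <= G j) -> \big[Rplus/0]_(j <- s) F j <= \big[Rplus/0]_(j <- s) G j.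
Proof.
move=> FG; apply: (big_ind2 Rle) => //; first exact: Rle_refl.
by move=> *; apply: Rplus_le_compat.
Qed.

Lemma big_Rplus_scal (I : Type) (s : seq I) (c : R) (F : I -> R) :
  \big[Rplus/0]_(j <- s) (c * F j) = c * \big[Rplus/0]_(j <- s) F j.
Proof.
symmetry; apply: (big_morph (Rmult c)); last exact: Rmult_0_r.
by move=> x y; apply: Rmult_plus_distr_l.
Qed.

Lemma big_Rplus_plus (I : Type) (s : seq I) (F G : I -> R) :
  \big[Rplus/0]_(j <- s) (F j + G j) =
  \big[Rplus/0]_(j <- s) F j + \big[Rplus/0]_(j <- s) G j.
Proof.
elim: s => [|j s IH]; first by rewrite !big_nil; ring.
by rewrite !big_cons IH; ring.
Qed.

Lemma big_Rplus_const (I : Type) (s : seq I) (c : R) :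
  \big[Rplus/0]_(j <- s) c = INR (size s) * c.
Proof.
elim: s => [|j s IH]; first by rewrite big_nil /=; ring.
have -> : INR (size (j :: s)) = INR (size s) + 1 by rewrite -S_INR.
by rewrite big_cons IH; ring.
Qed.

Lemma big_Rplus_ge0 (I : Type) (s : seq I) (F : I -> R) :
  (forall j, 0 <= F j) -> 0 <= \big[Rplus/0]_(j <- s) F j.
Proof.
move=> F0; apply: (big_ind (Rle 0)) => //; first exact: Rle_refl.
by move=> *; apply: Rplus_le_le_0_compat.
Qed.

Lemma big_Rplus_term (I : eqType) (s : seq I) (F : I -> R) (i : I) :
  (forall j, 0 <= F j) -> i \in s -> F i <= \big[Rplus/0]_(j <- s) F j.
Proof.
move=> F0; elim: s => [//|j s IH]; rewrite in_cons big_cons => /orP [/eqP <-|/IH].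
  by have := big_Rplus_ge0 _ s F F0; lra.
by have := F0 j; lra.
Qed.

Lemma size_index_enum_ord (n : nat) : size (index_enum 'I_n) = n.
Proof. by rewrite [index_enum _]unlock -enumT size_enum_ord. Qed.

Lemma sum_ord_le (n : nat) (F : 'I_n -> R) (m : R) : (forall j, F j <= m) ->
  \big[Rplus/0]_(j < n) F j <= INR n * m.
Proof.
move=> Fm; apply: Rle_trans (big_Rplus_le _ _ _ (fun _ => m) Fm) _.
by rewrite big_Rplus_const size_index_enum_ord; apply: Rle_refl.
Qed.

Lemma finite_upper_bound (n : nat) (F : 'I_n -> R) : exists B, 0 <= B /\ forall j, F j <= B.
Proof.
exists (\big[Rplus/0]_(j < n) Rabs (F j)); split.
  by apply: big_Rplus_ge0 => j; apply: Rabs_pos.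
move=> j; apply: Rle_trans (Rle_abs _) _.
apply: (big_Rplus_term _ _ (fun j => Rabs (F j))); last exact: mem_index_enum.
by move=> k; apply: Rabs_pos.
Qed.

Lemma cnorm_ge0 (n : nat) (z : Cn n) : 0 <= cnorm z.
Proof. exact: sqrt_pos. Qed.

Lemma cnorm_sqr (n : nat) (z : Cn n) :
  cnorm z ^ 2 = \big[Rplus/0]_(j < n) (Cmod (z j) ^ 2).
Proof. by apply: pow2_sqrt; apply: big_Rplus_ge0 => j; apply: pow2_ge_0. Qed.

Lemma Cmod_le_cnorm (n : nat) (z : Cn n) (j : 'I_n) : Cmod (z j) <= cnorm z.
Proof.
rewrite -(sqrt_pow2 (Cmod (z j))); last exact: Cmod_ge_0.
apply: sqrt_le_1_alt; apply: (big_Rplus_term _ _ (fun j => Cmod (z j) ^ 2)).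
  by move=> k; apply: pow2_ge_0.
exact: mem_index_enum.
Qed.

Lemma cnorm_mono (n : nat) (z w : Cn n) :
  (forall j, Cmod (z j) <= Cmod (w j)) -> cnorm z <= cnorm w.
Proof.
move=> zw; apply: sqrt_le_1_alt; apply: big_Rplus_le => j.
by apply: pow_incr; split; [apply: Cmod_ge_0|].
Qed.

Lemma cnorm_sqr_le (n : nat) (z : Cn n) (m : R) :
  (forall j, Cmod (z j) <= m) -> cnorm z ^ 2 <= INR n * m ^ 2.
Proof.
move=> zm; rewrite cnorm_sqr; apply: sum_ord_le => j.
by apply: pow_incr; split; [apply: Cmod_ge_0|].
Qed.

Lemma cnorm_le_sup (n : nat) (z : Cn n) (m : R) : 0 <= m ->
  (forall j, Cmod (z j) <= m) -> cnorm z <= (INR n + 1) * m.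
Proof.
move=> m0 /cnorm_sqr_le H; have n0 := pos_INR n.
apply: (Rsqr_incr_0_var); last by apply: Rmult_le_pos; lra.
move: H; rewrite /Rsqr /=; nra.
Qed.

(** A weak triangle inequality, obtained from |a + b|^2 <= 2 (|a|^2 + |b|^2) in each coordinate in
    place of Cauchy-Schwarz. *)
Lemma vsub_triangle_double (n : nat) (x y z : Cn n) (e : R) :
  cnorm (vsub x y) < e -> cnorm (vsub y z) < e -> cnorm (vsub x z) < 2 * e.
Proof.
move=> xy yz.
have xy0 := cnorm_ge0 _ (vsub x y); have yz0 := cnorm_ge0 _ (vsub y z).
have H : cnorm (vsub x z) ^ 2 <= 2 * (cnorm (vsub x y) ^ 2 + cnorm (vsub y z) ^ 2).
  rewrite !cnorm_sqr -big_Rplus_plus -big_Rplus_scal; apply: big_Rplus_le => j.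
  have -> : vsub x z j = (vsub x y j + vsub y z j)%C by rewrite /vsub; ring.
  have := Cmod_triangle (vsub x y j) (vsub y z j).
  have := Cmod_ge_0 (vsub x y j + vsub y z j)%C.
  move: (Cmod (_ + _)%C) (Cmod (vsub x y j)) (Cmod (vsub y z j)) => a b c a0 abc.
  have := pow_incr _ _ 2 (conj a0 abc); have := pow2_ge_0 (b - c); rewrite /=; nra.
apply: Rsqr_incrst_0; last lra; last exact: cnorm_ge0.
by move: H; rewrite /Rsqr /=; nra.
Qed.

(** Points of R^m are nested pairs in the compactness theorem for boxes; [to_Tn] and [of_Tn] pass
    between these and coordinate sequences. *)
Fixpoint to_Tn (m : nat) (x : nat -> R) : Compactness.Tn m R :=
  match m with
  | O => tt
  | S m => (x O, to_Tn m (fun i => x (S i)))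
  end.

Fixpoint of_Tn (m : nat) : Compactness.Tn m R -> nat -> R :=
  match m with
  | O => fun _ _ => 0
  | S m => fun t i => match i with O => fst t | S i => of_Tn m (snd t) i end
  end.

Lemma to_Tn_bounded (m : nat) (a b : R) (x : nat -> R) : (forall i, a <= x i <= b) ->
  bounded_n m (to_Tn m (fun _ => a)) (to_Tn m (fun _ => b)) (to_Tn m x).
Proof. by elim: m x => [//|m IH] x xab /=; split; [|apply: IH]. Qed.

Lemma close_to_Tn (m : nat) (d : R) (x : nat -> R) (t : Compactness.Tn m R) :
  close_n m d (to_Tn m x) t -> forall i, (i < m)%N -> Rabs (x i - of_Tn m t i) < d.
Proof.
elim: m x t => [//|m IH] x [t1 t2] /= [H1 H2] [|i] //= im.
exact: (IH (fun i => x (S i)) t2).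
Qed.

(** Identifies C^n with R^(2n): index 2j carries the real part and 2j+1 the imaginary part of the
    j-th coordinate, with 0 beyond. *)
Definition real_coords (n : nat) (z : Cn n) (i : nat) : R :=
  if insub i./2 is Some j then (if odd i then snd (z j) else fst (z j)) else 0.

Definition of_real_coords (n : nat) (x : nat -> R) : Cn n :=
  fun j => (x j.*2, x j.*2.+1).

Lemma real_coords_fst (n : nat) (z : Cn n) (j : 'I_n) : real_coords n z j.*2 = fst (z j).
Proof. by rewrite /real_coords doubleK odd_double valK. Qed.

Lemma real_coords_snd (n : nat) (z : Cn n) (j : 'I_n) : real_coords n z j.*2.+1 = snd (z j).
Proof. by rewrite /real_coords /= uphalf_double odd_double valK. Qed.

(** The Lebesgue number of a cover: a box containing [A] is compact, so the locally chosen radii can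
    be bounded below along a finite choice of centres. *)
Lemma lebesgue_number (n : nat) (A : Cn n -> Prop) (Q : Cn n -> R -> Prop) :
  cn_bounded A -> (forall p, cn_closure A p -> exists e, 0 < e /\ Q p e) ->
  exists e0, 0 < e0 /\ forall z, A z ->
    exists p e, e0 <= e /\ cnorm (vsub z p) < e /\ Q p e.
Proof.
move=> [M AM] AQ.
(* Every point of the box needs a radius; off the closure of [A] a ball missing [A] makes the
   condition vacuous. *)
have H p : exists e, 0 < e /\
    ((exists w, A w /\ cnorm (vsub w p) < e) -> Q p e).
  case: (excluded_middle_informative (cn_closure A p)) => [/AQ [e [e0 Qe]]|nA].
    by exists e; split.
  apply: NNPP => nH; apply: nA => d d0; apply: NNPP => nw; apply: nH.
  by exists d; split=> // -[w Hw]; case: nw; exists w.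
pose e p := proj1_sig (constructive_indefinite_description _ (H p)).
have eP p : 0 < e p /\ _ := proj2_sig (constructive_indefinite_description _ (H p)).
have n0 := pos_INR n.
(* Passing from real coordinates to moduli costs a factor 2, and to the norm a factor [INR n + 1];
   this size leaves distance at most [e p / 2]. *)
have dpos p : 0 < e p / (4 * (INR n + 1)).
  by apply: Rdiv_lt_0_compat; [case: (eP p)|lra].
pose m := n.*2.
pose pt t := of_real_coords n (of_Tn m t).
have [d Hd] := compactness_value m (to_Tn m (fun _ => - Rabs M)) (to_Tn m (fun _ => Rabs M))
  (fun t => mkposreal _ (dpos (pt t))).
exists d; split; first exact: cond_pos.
move=> z Az; apply: NNPP => nz.
have zb : forall i, - Rabs M <= real_coords n z i <= Rabs M.
  move=> i; apply/Rabs_le_between; rewrite /real_coords.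
  case: insub => [j|]; last by rewrite Rabs_R0; apply: Rabs_pos.
  have zM : Cmod (z j) <= Rabs M.
    by apply: Rle_trans (Cmod_le_cnorm _ z j) _; apply: Rle_trans (AM z Az) (Rle_abs _).
  case: odd; apply: Rle_trans zM; [exact: Rabs_snd_le_Cmod|exact: Rabs_fst_le_Cmod].
(* The compactness theorem gives its centre under a double negation, which fits the goal [False]. *)
apply: (Hd _ (to_Tn_bounded m _ _ _ zb)) => -[t [_ [tz dt]]]; apply: nz.
rewrite /= in dt tz; have [e0 eQ] := eP (pt t).
have de : e (pt t) / (4 * (INR n + 1)) <= e (pt t).
  by apply/Rle_div_l; nra.
have zt : cnorm (vsub z (pt t)) < e (pt t).
  apply: (Rle_lt_trans _ (e (pt t) / 2)); last lra.
  have -> : e (pt t) / 2 = (INR n + 1) * (2 * (e (pt t) / (4 * (INR n + 1)))).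
    by field; lra.
  apply: cnorm_le_sup => [|j]; first by have := dpos (pt t); lra.
  apply: Rle_trans (Cmod_le_2Rmax _) _.
  apply: Rmult_le_compat_l; first lra.
  have jn := ltn_ord j.
  have := close_to_Tn m _ _ _ tz; move=> C; apply: Rmax_lub; apply: Rlt_le.
  - have := C j.*2; rewrite real_coords_fst; apply.
    by rewrite /m ltn_double.
  - have := C j.*2.+1; rewrite real_coords_snd; apply.
    by rewrite /m ltn_Sdouble.
exists (pt t), (e (pt t)); split; first lra.
by split=> //; apply: eQ; exists z.
Qed.

Lemma linear_approximation (phi m : R -> R) (l x E : R) :
  (forall t, Rmin 0 x <= t <= Rmax 0 x -> is_derive phi t (m t) /\ Rabs (m t - l) <= E) ->
  Rabs (phi x - phi 0 - l * x) <= E * Rabs x.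
Proof.
move=> H; have [||c [cx ->]] := MVT_gen phi 0 x m.
- by move=> t t0x; apply: (proj1 (H t _)); lra.
- move=> t /H [/is_derive_Reals dt _].
  by apply: derivable_continuous_pt; exists (m t).
have -> : m c * (x - 0) - l * x = (m c - l) * x by ring.
rewrite Rabs_mult; apply: Rmult_le_compat_r; first exact: Rabs_pos.
exact: (proj2 (H c cx)).
Qed.

(** [dx] and [dy] are derivatives at parameter 0 of a shifted function; this turns them into
    derivatives at [t] along one fixed line. *)
Lemma is_derive_translate (phi : R -> R) (t l : R) :
  is_derive (fun s => phi (t + s)) 0 l -> is_derive phi t l.
Proof.
move=> d0; apply: (is_derive_ext (fun u => phi (t + (u - t)))).
  by move=> u; congr phi; ring.
have -> : l = scal 1 l by rewrite /scal /= /mult /=; ring.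
apply: (is_derive_comp (fun s => phi (t + s)) (fun u => u - t)).
  by have -> : t - t = 0 by ring.
by auto_derive => //; ring.
Qed.

Lemma Rabs_between_0 (t x : R) : Rmin 0 x <= t <= Rmax 0 x -> Rabs t <= Rabs x.
Proof. by rewrite /Rmin /Rmax; case: Rle_dec => ? ?; rewrite /Rabs; do 2 case: Rcase_abs; lra. Qed.

Lemma Cmod_mono (a b c d : R) : Rabs a <= Rabs c -> Rabs b <= Rabs d ->
  Cmod (a, b) <= Cmod (c, d).
Proof.
move=> ac bd; apply: sqrt_le_1_alt => /=; rewrite !Rmult_1_r.
by apply: Rplus_le_compat; apply: Rsqr_le_abs_1.
Qed.

(** The real differential of [r] at [z] applied to w - z, that is, Re <2 dr(z), w - z>. *)
Definition real_gradient_pairing (n : nat) (r : Cn n -> R) (z w : Cn n) : R :=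
  \big[Rplus/0]_(j < n) (dx r z j * fst (w j - z j)%C + dy r z j * snd (w j - z j)%C).

(* The coordinates are moved from [z] to [w] one at a time; each intermediate point is
   coordinatewise at least as close to [z] as [w] is. *)
Lemma taylor_lower_bound (n : nat) (r : Cn n -> R) (z w : Cn n) (d L : R) : 0 <= L ->
  (forall p, cnorm (vsub p z) < d -> forall j,
     ex_derive (fun t : R => r (shift p (RtoC t) j)) 0 /\
     ex_derive (fun t : R => r (shift p (Cmult (RtoC t) Ci) j)) 0) ->
  (forall p j, cnorm (vsub p z) < d ->
     Rabs (dx r p j - dx r z j) <= L * cnorm (vsub p z) /\
     Rabs (dy r p j - dy r z j) <= L * cnorm (vsub p z)) ->
  cnorm (vsub w z) < d ->
  real_gradient_pairing n r z w <= r w - r z + 2 * INR n * L * cnorm (vsub w z) ^ 2.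
Proof.
move=> L0 He HL wd; set D := cnorm (vsub w z).
have D0 : 0 <= D by apply: cnorm_ge0.
have LD0 : 0 <= L * D by apply: Rmult_le_pos.
pose mix (s : seq 'I_n) : Cn n := fun k => if k \in s then w k else z k.
pose T j := dx r z j * fst (w j - z j)%C + dy r z j * snd (w j - z j)%C.
have close p : (forall k, Cmod (p k - z k)%C <= Cmod (w k - z k)%C) ->
    cnorm (vsub p z) <= D by move=> H; apply: cnorm_mono.
have step j s : j \notin s -> r (mix (j :: s)) - r (mix s) >= T j - 2 * (L * D * D).
  move=> js; set x := fst (w j - z j)%C; set y := snd (w j - z j)%C.
  have wj : (w j - z j)%C = (x, y) by rewrite /x /y -surjective_pairing.
  have wD : Cmod (x, y) <= D by rewrite -wj; apply: (Cmod_le_cnorm n (vsub w z)).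
  have xD : Rabs x <= D by apply: Rle_trans wD; apply: (Rabs_fst_le_Cmod (x, y)).
  have yD : Rabs y <= D by apply: Rle_trans wD; apply: (Rabs_snd_le_Cmod (x, y)).
  (* Coordinate [j] moves in two legs, the real part from [p] to [q] and then the imaginary part;
     each leg errs by at most L D^2. *)
  set p := mix s; set q := shift p (RtoC x) j.
  have pk k : k != j -> Cmod (p k - z k)%C <= Cmod (w k - z k)%C.
    move=> _; rewrite /p /mix; case: (k \in s); first lra.
    have -> : (z k - z k)%C = RtoC 0 by ring.
    by rewrite Cmod_0; apply: Cmod_ge_0.
  have pj : p j = z j by rewrite /p /mix (negbTE js).
  have shiftE (u : Cn n) c k : shift u c j k = if k == j then (u k + c)%C else u k.
    by rewrite /shift /ej; case: eqP => _; ring.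
  have shiftD (u : Cn n) a b : shift (shift u a j) b j = shift u (a + b)%C j.
    by apply: functional_extensionality => k; rewrite !shiftE; case: eqP => _ //; ring.
  have shift0 (u : Cn n) : shift u (RtoC 0) j = u.
    by apply: functional_extensionality => k; rewrite !shiftE; case: eqP => _ //; ring.
  have qE : mix (j :: s) = shift q (RtoC y * Ci)%C j.
    rewrite /q shiftD; apply: functional_extensionality => k.
    rewrite shiftE /mix in_cons; case: eqP => [->|kj] /=.
      rewrite pj; have -> : w j = (z j + (w j - z j))%C by ring.
      by rewrite wj; apply: injective_projections => /=; ring.
    by rewrite /p /mix.
  have near1 t : Rmin 0 x <= t <= Rmax 0 x -> cnorm (vsub (shift p (RtoC t) j) z) <= D.
    move=> /Rabs_between_0 tx; apply: close => k; rewrite shiftE; case: eqP => [->|/eqP /pk //].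
    rewrite pj wj; have -> : (z j + RtoC t - z j)%C = (t, 0).
      by apply: injective_projections => /=; ring.
    by apply: Cmod_mono => //; rewrite Rabs_R0; apply: Rabs_pos.
  have near2 t : Rmin 0 y <= t <= Rmax 0 y ->
      cnorm (vsub (shift q (RtoC t * Ci)%C j) z) <= D.
    move=> /Rabs_between_0 ty; apply: close => k; rewrite /q shiftD shiftE.
    case: eqP => [->|/eqP /pk //].
    rewrite pj wj; have -> : (z j + (RtoC x + RtoC t * Ci) - z j)%C = (x, t).
      by apply: injective_projections => /=; ring.
    by apply: Cmod_mono => //; apply: Rle_refl.
  have A1 : Rabs (r q - r p - dx r z j * x) <= L * D * Rabs x.
    have := linear_approximation (fun t => r (shift p (RtoC t) j))
      (fun t => dx r (shift p (RtoC t) j) j) (dx r z j) x (L * D).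
    rewrite shift0 -/q; apply=> t /near1 tD; split.
      apply: is_derive_translate.
      have [|e1 _] := He (shift p (RtoC t) j) _ j; first by apply: Rle_lt_trans tD wd.
      have := Derive_correct _ _ e1; apply: is_derive_ext => s'.
      by rewrite shiftD RtoC_plus.
    have [|H _] := HL (shift p (RtoC t) j) j; first by apply: Rle_lt_trans tD wd.
    by apply: Rle_trans H _; apply: Rmult_le_compat_l.
  have A2 : Rabs (r (mix (j :: s)) - r q - dy r z j * y) <= L * D * Rabs y.
    have := linear_approximation (fun t => r (shift q (RtoC t * Ci)%C j))
      (fun t => dy r (shift q (RtoC t * Ci)%C j) j) (dy r z j) y (L * D).
    rewrite Cmult_0_l shift0 -qE; apply=> t /near2 tD; split.
      apply: is_derive_translate.
      have [|_ e1] := He (shift q (RtoC t * Ci)%C j) _ j; first by apply: Rle_lt_trans tD wd.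
      have := Derive_correct _ _ e1; apply: is_derive_ext => s'.
      by rewrite shiftD RtoC_plus Cmult_plus_distr_r.
    have [|_ H] := HL (shift q (RtoC t * Ci)%C j) j; first by apply: Rle_lt_trans tD wd.
    by apply: Rle_trans H _; apply: Rmult_le_compat_l.
  have B1 : L * D * Rabs x <= L * D * D by apply: Rmult_le_compat_l.
  have B2 : L * D * Rabs y <= L * D * D by apply: Rmult_le_compat_l.
  move/Rabs_le_between: A1 => A1; move/Rabs_le_between: A2 => A2.
  by rewrite /T -/x -/y; lra.
(* Uniqueness ensures that the coordinate being moved still has its value from [z]. *)
have path (s : seq 'I_n) : uniq s ->
    \big[Rplus/0]_(j <- s) T j <= r (mix s) - r z + INR (size s) * (2 * (L * D * D)).
  elim: s => [_|j s IH].
    rewrite big_nil; have -> : mix [::] = z by apply: functional_extensionality.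
    by rewrite /=; lra.
  rewrite cons_uniq => /andP [js /IH {}IH]; rewrite big_cons.
  have := step j s js.
  have -> : INR (size (j :: s)) = INR (size s) + 1 by rewrite -S_INR.
  move: IH; move: (\big[Rplus/0]_(_ <- s) _) (r (mix s)) (r (mix (j :: s))) (T j) => S a b t.
  clear; move: (INR (size s)) (L * D * D) (r z) => i e c; lra.
have := path _ (index_enum_uniq 'I_n).
rewrite size_index_enum_ord; have -> : mix (index_enum 'I_n) = w.
  by apply: functional_extensionality => k; rewrite /mix mem_index_enum.
rewrite /real_gradient_pairing /= => H; apply: Rle_trans H _; apply: Req_le; ring.
Qed.

(** Boundedness makes the closure of [Om] compact, so the local radii and Lipschitz constants of the
    gradient become uniform. *)
Lemma C11_uniform (n : nat) (U : Cn n -> Prop) (r : Cn n -> R) (Om : Cn n -> Prop) :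
  (forall z, cn_closure Om z -> U z) -> C11_on U r -> cn_bounded Om ->
  exists d L, 0 < d /\ 0 <= L /\ forall z, Om z ->
    (forall w, cnorm (vsub w z) < d -> U w) /\
    (forall w j, cnorm (vsub w z) < d ->
       Rabs (dx r w j - dx r z j) <= L * cnorm (vsub w z) /\
       Rabs (dy r w j - dy r z j) <= L * cnorm (vsub w z)) /\
    (forall j, Rabs (dx r z j) <= L /\ Rabs (dy r z j) <= L).
Proof.
move=> clU [_ C11] bOm.
(* One number [e] encodes a radius and the bound [/ e], so a lower bound on [e] controls everything
   at once. The radius [2 * e] leaves room to move the centre from [p] to a nearby [z]. *)
pose Q p e := (forall w, cnorm (vsub w p) < 2 * e -> U w) /\
  (forall z w j, cnorm (vsub z p) < 2 * e -> cnorm (vsub w p) < 2 * e ->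
     Rabs (dx r z j - dx r w j) <= / e * cnorm (vsub z w) /\
     Rabs (dy r z j - dy r w j) <= / e * cnorm (vsub z w)) /\
  (forall j, Rabs (dx r p j) <= / e /\ Rabs (dy r p j) <= / e).
have [|e0 [e00 H]] := lebesgue_number n Om Q bOm.
  move=> p /clU /C11 [d [L [d0 [dU dL]]]].
  have [B1 [B10 HB1]] := finite_upper_bound n (fun j => Rabs (dx r p j)).
  have [B2 [B20 HB2]] := finite_upper_bound n (fun j => Rabs (dy r p j)).
  have d20 : 0 < 2 / d by apply: Rdiv_lt_0_compat; lra.
  have L0 := Rabs_pos L; have LL := Rle_abs L.
  pose m := 2 / d + Rabs L + B1 + B2.
  have m0 : 0 < m by rewrite /m; lra.
  have e2 : 2 * / m <= d.
    apply/Rle_div_l => //.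
    have -> : 2 = d * (2 / d) by field; lra.
    by apply: Rmult_le_compat_l; rewrite /m; lra.
  exists (/ m); split; first exact: Rinv_0_lt_compat.
  rewrite /Q Rinv_inv; split; [|split].
  - by move=> w wp; apply: dU; lra.
  - move=> z w j zp wp; have [||D1 D2] := dL z w j; try lra.
    have := cnorm_ge0 n (vsub z w) => c0.
    have LM : L * cnorm (vsub z w) <= m * cnorm (vsub z w).
      by apply: Rmult_le_compat_r; rewrite /m; lra.
    by split; lra.
  - by move=> j; have := HB1 j; have := HB2 j; rewrite /m; lra.
have ie0 : 0 < / e0 by apply: Rinv_0_lt_compat.
(* The summand 1 absorbs the change of the gradient between [p] and [z], at most [/ e * e]. *)
exists e0, (1 + / e0); split=> //; split; first lra.
move=> z /H [p [e [e0e [zp [QU [QL QB]]]]]].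
have ie : / e <= / e0 by apply: Rinv_le_contravar.
have ie1 : 0 < / e by apply: Rinv_0_lt_compat; lra.
have zp2 : cnorm (vsub z p) < 2 * e by lra.
have wp2 w : cnorm (vsub w z) < e0 -> cnorm (vsub w p) < 2 * e.
  by move=> wz; apply: (vsub_triangle_double n w z p e) => //; lra.
split; [by move=> w /wp2 /QU|split].
- move=> w j /wp2 wp; have [D1 D2] := QL w z j wp zp2.
  have c0 := cnorm_ge0 n (vsub w z).
  have LM : / e * cnorm (vsub w z) <= (1 + / e0) * cnorm (vsub w z).
    by apply: Rmult_le_compat_r; lra.
  by split; lra.
- move=> j; have pp : cnorm (vsub p p) < 2 * e.
    apply: Rle_lt_trans (cnorm_mono n _ (vsub z p) _) zp2 => k.
    rewrite /vsub; have -> : (p k - p k)%C = RtoC 0 by ring.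
    by rewrite Cmod_0; apply: Cmod_ge_0.
  have [D1 D2] := QL z p j zp2 pp.
  have LM : / e * cnorm (vsub z p) <= 1.
    have -> : 1 = / e * e by field; lra.
    by apply: Rmult_le_compat_l; lra.
  have [B1 B2] := QB j.
  have T1 := Rabs_triang (dx r z j - dx r p j) (dx r p j).
  have T2 := Rabs_triang (dy r z j - dy r p j) (dy r p j).
  have E1 : dx r z j - dx r p j + dx r p j = dx r z j by ring.
  have E2 : dy r z j - dy r p j + dy r p j = dy r z j by ring.
  by rewrite E1 in T1; rewrite E2 in T2; split; lra.
Qed.

(* Close to [z] this is Taylor's inequality together with [r w < 0]; away from [z] the
   pairing is bounded and the quadratic term absorbs it. *)
Lemma gradient_pairing_upper_bound (n : nat) (U : Cn n -> Prop) (r : Cn n -> R)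
    (Om : Cn n -> Prop) :
  (forall z, cn_closure Om z -> U z) -> C11_on U r -> cn_bounded Om ->
  (forall z, Om z <-> (U z /\ (r z < 0)%R)) ->
  exists K, 0 <= K /\ forall z w, Om z -> Om w ->
    real_gradient_pairing n r z w <= - r z + K * cnorm (vsub w z) ^ 2 /\
    real_gradient_pairing n r z w <= K.
Proof.
move=> clU C11 bOm OmE.
have [d [L [d0 [L0 H]]]] := C11_uniform n U r Om clU C11 bOm.
have [M HM] := bOm.
have n0 := pos_INR n; have M0 := Rabs_pos M.
(* Each of the [n] terms is at most 2 L times a coordinate difference, itself at most 2 |M|. *)
pose A := INR n * (4 * L * Rabs M).
have A0 : 0 <= A by rewrite /A; do ! apply: Rmult_le_pos; lra.
have d2 : 0 < d ^ 2 by apply: pow_lt.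
have Ad : 0 <= A / d ^ 2 by apply: Rdiv_le_0_compat.
have nL : 0 <= 2 * INR n * L by do ! apply: Rmult_le_pos; lra.
(* [A] bounds the pairing outright, [A / d ^ 2] makes the quadratic term exceed [A] at distance at
   least [d], and the last summand is Taylor's constant. *)
exists (A + A / d ^ 2 + 2 * INR n * L); split; first lra.
move=> z w Oz Ow; have [HU [HL HB]] := H z Oz.
have c0 : 0 <= cnorm (vsub w z) ^ 2 by apply: pow2_ge_0.
have PA : real_gradient_pairing n r z w <= A.
  apply: sum_ord_le => j; have [B1 B2] := HB j.
  have wz : Cmod (w j - z j)%C <= 2 * Rabs M.
    apply: Rle_trans (Cmod_triangle _ _) _; rewrite Cmod_opp.
    have := Rle_trans _ _ _ (Cmod_le_cnorm n w j) (HM w Ow).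
    have := Rle_trans _ _ _ (Cmod_le_cnorm n z j) (HM z Oz).
    by have := Rle_abs M; lra.
  have F1 := Rle_trans _ _ _ (Rabs_fst_le_Cmod _) wz.
  have F2 := Rle_trans _ _ _ (Rabs_snd_le_Cmod _) wz.
  have P1 := Rmult_le_compat _ _ _ _ (Rabs_pos _) (Rabs_pos _) B1 F1.
  have P2 := Rmult_le_compat _ _ _ _ (Rabs_pos _) (Rabs_pos _) B2 F2.
  rewrite -!Rabs_mult in P1 P2.
  have := Rle_abs (dx r z j * fst (w j - z j)%C).
  have := Rle_abs (dy r z j * snd (w j - z j)%C).
  lra.
have rz : r z < 0 by case/OmE: Oz.
have rw : r w < 0 by case/OmE: Ow.
split; last lra.
rewrite !Rmult_plus_distr_r.
have t1 : 0 <= A * cnorm (vsub w z) ^ 2 by apply: Rmult_le_pos.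
have t2 : 0 <= A / d ^ 2 * cnorm (vsub w z) ^ 2 by apply: Rmult_le_pos.
have t3 : 0 <= 2 * INR n * L * cnorm (vsub w z) ^ 2 by apply: Rmult_le_pos.
case: (Rlt_le_dec (cnorm (vsub w z)) d) => wd.
  have [C1 _] := C11.
  have := taylor_lower_bound n r z w d L L0 (fun p pd => C1 p (HU p pd)) HL wd.
  lra.
have t4 : A <= A / d ^ 2 * cnorm (vsub w z) ^ 2.
  have {1}-> : A = A / d ^ 2 * d ^ 2 by field; lra.
  by apply: Rmult_le_compat_l => //; apply: pow_incr; lra.
lra.
Qed.

(** * The estimate for one disc and the lower bound on the metric *)

Lemma C_is_derive_big (I : Type) (s : seq I) (f : I -> C -> C) (l : I -> C) (w : C) :
  (forall j, C_is_derive (f j) w (l j)) ->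
  C_is_derive (fun u => \big[Cplus/RtoC 0]_(j <- s) f j u) w
    (\big[Cplus/RtoC 0]_(j <- s) l j).
Proof.
move=> dl; elim: s => [|j s IH].
  rewrite big_nil; apply: (C_is_derive_ext_loc (fun _ => RtoC 0) _ _ _ 1); first lra.
    by move=> y _; rewrite big_nil.
  exact: C_is_derive_const.
rewrite big_cons.
apply: (C_is_derive_ext_loc (fun u => f j u + \big[Cplus/RtoC 0]_(j <- s) f j u)%C _ _ _ 1).
- lra.
- by move=> y _; rewrite big_cons.
- exact: C_is_derive_plus.
Qed.

Lemma big_Cplus_scal (I : Type) (s : seq I) (c : C) (F : I -> C) :
  \big[Cplus/RtoC 0]_(j <- s) (c * F j)%C = (c * \big[Cplus/RtoC 0]_(j <- s) F j)%C.
Proof.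
symmetry; apply: (big_morph (Cmult c)); last exact: Cmult_0_r.
by move=> x y; apply: Cmult_plus_distr_l.
Qed.

Lemma disc_derivative_bound (n : nat) (r : Cn n -> R) (Om : Cn n -> Prop) (M K : R) :
  (forall z, Om z -> cnorm z <= M) -> 0 <= K ->
  (forall z w, Om z -> Om w ->
     real_gradient_pairing n r z w <= - r z + K * cnorm (vsub w z) ^ 2 /\
     real_gradient_pairing n r z w <= K) ->
  forall (f : C -> Cn n) (Y : Cn n), holo_disc_into Om f -> r (f (RtoC 0)) < 0 ->
  (forall j, C_is_derive (fun u => f u j) (RtoC 0) (Y j)) ->
  Cmod (dpair r (f (RtoC 0)) Y) <=
    (8 + 4 * K + K * (INR n * (64 * M) ^ 2)) * sqrt (- r (f (RtoC 0))).
Proof.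
move=> OmM K0 HK f Y Hf rz dY.
set z := f (RtoC 0) in rz *.
have n0 := pos_INR n.
have Oz : Om z by case: (Hf (RtoC 0)) => //; rewrite Cmod_0; lra.
have fh j : C_holomorphic_on_disc (fun u => f u j).
  by move=> w /Hf [_ /(_ j)].
have fM j w : Cmod w < 1 -> Cmod (f w j) <= M.
  by move=> /Hf [Ow _]; apply: Rle_trans (Cmod_le_cnorm n _ j) (OmM _ Ow).
set b := dpair r z Y.
pose g u := \big[Cplus/RtoC 0]_(j < n) (RtoC 2 * dz r z j * (f u j + - z j))%C.
have dterm j w l : C_is_derive (fun u => f u j) w l ->
    C_is_derive (fun u => RtoC 2 * dz r z j * (f u j + - z j))%C w (RtoC 2 * (dz r z j * l))%C.
  move=> dl; have := C_is_derive_mult _ _ w _ _ (C_is_derive_const (RtoC 2 * dz r z j)%C w)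
    (C_is_derive_plus _ _ w _ _ dl (C_is_derive_const (- z j)%C w)).
  congr C_is_derive; ring.
have dg : C_holomorphic_on_disc g.
  move=> w w1; have dl j := fh j w w1.
  pose l j := proj1_sig (constructive_indefinite_description _ (dl j)).
  have lP j := proj2_sig (constructive_indefinite_description _ (dl j)).
  eexists; apply: C_is_derive_big => j; exact: (dterm j w (l j) (lP j)).
have g0 : g (RtoC 0) = RtoC 0.
  rewrite /g; elim: (index_enum _) => [|j s IH]; first by rewrite big_nil.
  by rewrite big_cons IH -/z; ring.
have db : C_is_derive g (RtoC 0) (RtoC 2 * b)%C.
  rewrite /b /dpair -big_Cplus_scal; apply: C_is_derive_big => j; exact: dterm.
(* Twice [dz] is dx - i dy, so the real part of each term is the real differential in that
   coordinate. *)
have gS w : fst (g w) = real_gradient_pairing n r z (f w).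
  rewrite /g /real_gradient_pairing; elim: (index_enum _) => [|j s IH].
    by rewrite !big_nil.
  rewrite !big_cons -IH /= /dz /=; field.
have bE : Cmod (RtoC 2 * b)%C = 2 * Cmod b.
  by rewrite Cmod_mult Cmod_R Rabs_pos_eq; lra.
set s := sqrt (- r z).
have s2 : s * s = - r z by apply: sqrt_sqrt; lra.
have s0 : 0 < s by apply: sqrt_lt_R0; lra.
set K1 := K * (INR n * (64 * M) ^ 2).
have K10 : 0 <= K1.
  by rewrite /K1; apply: Rmult_le_pos => //; apply: Rmult_le_pos => //; apply: pow2_ge_0.
(* For [s >= 1] the fixed radius 1/2 and the bound [K] give |b| <= 4 K <= 4 K s. *)
case: (Rlt_le_dec s 1) => s1; last first.
  have := borel_caratheodory_derive g _ (/ 2) K ltac:(lra) K0 dg g0 db.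
  rewrite bE => H.
  have : / 2 * (2 * Cmod b) <= 4 * K.
    apply: H => w wr; rewrite gS.
    have [|Ow _] := Hf w; first lra.
    exact: (proj2 (HK z _ Oz Ow)).
  nra.
(* For [s < 1] the radius [s / 4] is below 1/2, as [C_growth_bound] requires, and both summands of
   the bound are of order s^2. Dividing by [s / 2] gives |b| <= (8 + K1 / 2) s. *)
have := borel_caratheodory_derive g _ (s / 4) (s * s + K1 * (s / 4) ^ 2) ltac:(lra) _ dg g0 db.
rewrite bE => H.
have : s / 4 * (2 * Cmod b) <= 4 * (s * s + K1 * (s / 4) ^ 2).
  apply: H; first by have := pow2_ge_0 (s / 4); nra.
  move=> w wr; rewrite gS.
  have [|Ow _] := Hf w; first lra.
  apply: Rle_trans (proj1 (HK z _ Oz Ow)) _.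
  rewrite -s2; apply: Rplus_le_compat_l.
  rewrite /K1 Rmult_assoc; apply: Rmult_le_compat_l => //.
  rewrite Rmult_assoc -Rpow_mult_distr.
  apply: cnorm_sqr_le => j; rewrite -wr.
  by apply: (C_growth_bound (fun u => f u j) M w (fh j) (fM j)); lra.
move=> H1.
have : s * Cmod b <= s * ((8 + K1 / 2) * s) by rewrite /= in H1; lra.
move=> /(Rmult_le_reg_l _ _ _ s0); nra.
Qed.

Theorem theorem2p5 (n : nat) (U : Cn n -> Prop) (r : Cn n -> R)
    (Om : Cn n -> Prop) :
  cn_open_set U ->
  (forall z, cn_closure Om z -> U z) ->
  C11_on U r ->
  (forall z, Om z <-> (U z /\ (r z < 0)%R)) ->
  cn_domain Om ->
  cn_bounded Om ->
  (forall p, cn_bdry Om p -> dr_nonzero r p) ->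
  exists c : R, (0 < c)%R /\
    forall z X : Cn n, Om z ->
      Rbar_le (Rbar.Finite (Rdiv (Rmult c (Cmod (dpair r z X))) (sqrt (Rabs (r z)))))
              (kobayashi Om z X).
Proof.
move=> _ clU C11 OmE _ bOm _.
have [K [K0 HK]] := gradient_pairing_upper_bound n U r Om clU C11 bOm OmE.
have [M HM] := bOm.
set B := 8 + 4 * K + K * (INR n * (64 * M) ^ 2).
have B0 : 0 < B.
  have : 0 <= K * (INR n * (64 * M) ^ 2).
    apply: Rmult_le_pos => //; apply: Rmult_le_pos; [exact: pos_INR|exact: pow2_ge_0].
  by rewrite /B; lra.
exists (/ B); split; first exact: Rinv_0_lt_compat.
move=> z X Oz; have rz : r z < 0 by case/OmE: Oz.
have s0 : 0 < sqrt (- r z) by apply: sqrt_lt_R0; lra.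
(* The infimum dominates every lower bound of the admissible values [/ lam], so a single disc is
   considered; its derivative [lam * X] enters the pairing linearly. *)
apply: (proj2 (Glb_Rbar_correct _)) => x [f [lam [lam0 [-> [Hf [f0 df]]]]]] /=.
have fz : f (RtoC 0) = z by apply: functional_extensionality.
have := disc_derivative_bound n r Om M K HM K0 HK f (fun j => RtoC lam * X j)%C Hf.
rewrite fz => /(_ rz df).
have -> : dpair r z (fun j => RtoC lam * X j)%C = (RtoC lam * dpair r z X)%C.
  rewrite /dpair -big_Cplus_scal; apply: eq_bigr => j _; ring.
rewrite Cmod_mult Cmod_R Rabs_pos_eq; last lra.
rewrite Rabs_left // -/B => H.
apply/Rle_div_l => //.
apply: (Rmult_le_reg_l (B * lam)); first exact: Rmult_lt_0_compat.
have -> : B * lam * (/ B * Cmod (dpair r z X)) = lam * Cmod (dpair r z X) by field; lra.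
by have -> : B * lam * (/ lam * sqrt (- r z)) = B * sqrt (- r z) by field; lra.
Qed.
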